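(* Let $B\subset\mathbb{R}^2$ be the open unit ball, let $0<\gamma<\infty$ and let $\rho$ be as described in the context. Then the identity map $u=\mathrm{Id}$ (which is smooth) is the unique global minimizer of $$I(u)=\int_B\tfrac12|\nabla u|^2+\rho(\det\nabla u)\,dx$$ in the class $\{u\in W^{1,2}(B,\mathbb{R}^2): u=\mathrm{Id}\text{ on }\partial B\text{ in the trace sense}\}$.
   Context: The function $\rho\in C^\infty(\mathbb{R})$ is given by $\rho(s)=0$ for $s\le 0$, $\rho(s)=\rho_1(s)$ for $0\le s\le s_0$, and $\rho(s)=\gamma s+\kappa$ for $s\ge s_0$, where $\gamma>0$, $s_0\ge0$, $\kappa\ge-\gamma s_0$ are constants and $\rho_1:[0,s_0]\to\mathbb{R}$ is smooth and convex with $\rho_1(0)=0$, $\rho_1(s_0)=\gamma s_0+\kappa$, the pieces being connected so that $\rho$ is smooth on $\mathbb{R}$; $\rho$ is convex on $\mathbb{R}$. *)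

(* Defs.v *)
From HB Require Import structures.
From mathcomp Require Import all_boot all_order all_algebra.
From mathcomp Require Import all_classical all_reals all_analysis.

Set Implicit Arguments.
Unset Strict Implicit.
Unset Printing Implicit Defensive.

Import Order.TTheory GRing.Theory Num.Theory.
Import numFieldNormedType.Exports.

Local Open Scope classical_set_scope.
Local Open Scope ring_scope.

Section SquareIntegrable.
Context d (T : measurableType d) (R : realType).
Variables (mu : {measure set T -> \bar R}) (D : set T).

Definition sqL2norm (f : T -> R) : \bar R :=
  (\int[mu]_(x in D) (f x ^+ 2)%:E)%E.

(* Representatives of elements of L^2(D): values outside D are irrelevant. *)
Definition in_L2 (f : T -> R) : Prop :=
  measurable_fun D f /\ (sqL2norm f < +oo)%E.

Definition cvg_L2 (w : nat -> T -> R) (f : T -> R) : Prop :=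
  (fun n => sqL2norm (w n \- f)) @ \oo --> 0%E.

End SquareIntegrable.

Section Plane.
Variable R : realType.
Implicit Types (x : R * R) (f g : R * R -> R) (i j : 'I_2).

Definition component i x : R := if i == 0 then x.1 else x.2.

Definition basis_vec i : R * R := ((i == 0)%:R, (i == 1)%:R).

Definition area : {measure set (measurableTypeR R * measurableTypeR R) -> \bar R} :=
  (@lebesgue_measure R \x @lebesgue_measure R)%E.

(* The Euclidean unit ball; the library norm of R * R is the sup norm. *)
Definition unit_ball : set (R * R) := [set x | x.1 ^+ 2 + x.2 ^+ 2 < 1].

Definition partial i f : R * R -> R := fun x => 'D_(basis_vec i) f x.

Fixpoint class_C k f : Prop :=
  continuous f /\
  if k is k'.+1 then
    forall i, (forall x, derivable f x (basis_vec i)) /\ class_C k' (partial i f)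
  else True.

Definition smooth f : Prop := forall k, class_C k f.

Definition smooth_map (u : R * R -> R * R) : Prop :=
  forall j, smooth (component j \o u).

Definition test_function (phi : R * R -> R) : Prop :=
  [/\ smooth phi,
      compact (closure [set x | phi x != 0]) &
      closure [set x | phi x != 0] `<=` unit_ball].

(* g is a weak i-th partial derivative of f on the ball, in L^2. *)
Definition is_weak_partial i f g : Prop :=
  in_L2 area unit_ball g /\
  forall phi, test_function phi ->
    \int[area]_(x in unit_ball) (f x * partial i phi x) =
    - \int[area]_(x in unit_ball) (g x * phi x).

(* A chosen representative of the weak partial derivative, which is unique up
   to a null set; meaningful only when a weak partial derivative exists. *)
Definition weak_partial i f : R * R -> R := get [set g | is_weak_partial i f g].

Definition W12 f : Prop :=
  in_L2 area unit_ball f /\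
  forall i, exists g : R * R -> R, is_weak_partial i f g.

Definition circle_point (t : R) : R * R := (cos t, sin t).

(* The trace operator W^{1,2}(B) -> L^2(bd B) is the continuous extension of
   w |-> w|_{bd B} from smooth functions up to the boundary (restrictions to
   the closed ball of smooth functions on the plane), which are dense in
   W^{1,2}(B); this is its graph.  Arc length on bd B is Lebesgue measure on
   [0, 2 pi] through circle_point. *)
Definition has_trace f g : Prop :=
  in_L2 (@lebesgue_measure R) `[0, 2 * pi] (g \o circle_point) /\
  exists w : nat -> R * R -> R,
    [/\ forall n, smooth (w n),
        cvg_L2 area unit_ball w f,
        forall i, cvg_L2 area unit_ball
                    (fun n => partial i (w n)) (weak_partial i f) &
        cvg_L2 (@lebesgue_measure R) `[0, 2 * pi]
               (fun n => w n \o circle_point) (g \o circle_point)].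

Implicit Types u : R * R -> R * R.

Definition W12_map u : Prop := forall j, W12 (component j \o u).

Definition has_trace_map u (g : R * R -> R * R) : Prop :=
  forall j, has_trace (component j \o u) (component j \o g).

Definition weak_grad u x : 'M[R]_2 :=
  \matrix_(j, i) weak_partial i (component j \o u) x.

Definition sqnorm_mx (A : 'M[R]_2) : R := \sum_j \sum_i A j i ^+ 2.

Definition energy (rho : R -> R) u : \bar R :=
  (\int[area]_(x in unit_ball)
     (2^-1 * sqnorm_mx (weak_grad u x) + rho (\det (weak_grad u x)))%:E)%E.

Definition admissible u : Prop := W12_map u /\ has_trace_map u id.

Definition global_minimizer (I : (R * R -> R * R) -> \bar R)
    (A : set (R * R -> R * R)) u : Prop :=
  A u /\ forall v, A v -> (I u <= I v)%E.

(* C^oo on the line; on [0, s0] it means having a C^oo extension. *)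
Definition smooth1 (h : R -> R) : Prop :=
  forall (n : nat) (s : R), derivable (derive1n n h) s 1.

Definition smooth1_on (s0 : R) (h : R -> R) : Prop :=
  exists2 h' : R -> R, smooth1 h' & forall s : R, 0 <= s <= s0 -> h s = h' s.

Record stored_energy (gamma s0 kappa : R) (rho1 rho : R -> R) : Prop := {
  stored_s0_ge0 : 0 <= s0;
  stored_kappa_ge : - gamma * s0 <= kappa;
  stored_rho1_smooth : smooth1_on s0 rho1;
  stored_rho1_convex : @convex_function R R^o `[0, s0] rho1;
  stored_rho1_0 : rho1 0 = 0;
  stored_rho1_s0 : rho1 s0 = gamma * s0 + kappa;
  stored_rho_neg : forall s : R, s <= 0 -> rho s = 0;
  stored_rho_mid : forall s : R, 0 <= s <= s0 -> rho s = rho1 s;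
  stored_rho_large : forall s : R, s0 <= s -> rho s = gamma * s + kappa;
  stored_rho_smooth : smooth1 rho;
  stored_rho_convex : @convex_function R R^o setT rho
}.

End Plane.

(* Main.v *)
Require Import Defs.
From mathcomp Require Import all_boot all_order all_algebra.
From mathcomp Require Import all_classical all_reals all_analysis.
From mathcomp Require Import measurable_realfun.
From mathcomp Require Import ring lra.

Set Implicit Arguments.
Unset Strict Implicit.
Unset Printing Implicit Defensive.

Import Order.TTheory GRing.Theory Num.Theory.
Import numFieldNormedType.Exports.

Local Open Scope classical_set_scope.
Local Open Scope ring_scope.

(** A convex differentiable rho lies above its tangent at 1.  Hence, with
m = rho'(1), the energy density at a matrix G is at least
    1 + rho(1) + (tr G - 2) + m (det G - 1) + |G - Id|^2 / 2
(energy_minorantP).  The trace and the determinant are null Lagrangians: the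
integrals of div u and det (grad u) over the disc depend only on the boundary
values of u, so the two middle terms integrate to 0 for every admissible u.
Therefore I(u) >= I(Id) + 1/2 int |grad u - Id|^2 (energy_lower_bound).  This
makes Id a minimizer; and if u is another one, then grad u = Id almost
everywhere, so that u - Id has zero gradient and zero trace, and vanishes by a
Poincare inequality with a boundary term (trace_Poincare, trace_grad_unique).

The delicate point is the integral of the determinant (jac_trace2), because
the approximating smooth maps converge on the circle in L^2 only, without
their tangential derivatives.  For smooth w and b, Green's formula and the
symmetry of second derivatives give
    int_disc (w_x b_y - w_y b_x) = int_circle w (d b / d tau)
(jac_boundary), where the boundary derivative falls on b alone.  So one passes
to the limit in w with b fixed, which gives jac_trace, and only then in b.
When b is a coordinate the same identity computes the integrals of the entries
of grad u, hence that of div u.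

The energy involves a chosen representative of the weak gradient.  To evaluate
it at Id, and to see that Id is admissible, one needs the uniqueness of weak
derivatives, that is, the fundamental lemma of the calculus of variations:
products of functions exp (- 1 / s) give test functions that converge to the
indicators of the traces on the disc of quadrants, and quadrants generate the
Borel sets.

Green's formula itself is Fubini's theorem together with the fundamental
theorem of calculus along horizontal or vertical chords; the integral over the
ends of the chords becomes an integral over the angle by the substitutions
y = sin t and x = cos t. *)

(** * Smooth functions on the plane *)

Section SmoothCalculus.
Variable R : realType.
Implicit Types (f g p : R * R -> R) (x v : R * R) (i j : 'I_2) (k : nat).

(** Reduces the calculus of directional derivatives to that of functions of one real
variable. *)
Lemma is_derive_line (V : normedModType R) (f : V -> R) (x v : V) (df : R) :
  is_derive x v f df <-> is_derive (0 : R) 1 (fun h : R => f (h *: v + x)) df.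
Proof.
have E : (fun h : R => h^-1 *: (f (h *: v + x) - f x)) =
  (fun h : R => h^-1 *: ((fun h : R => f (h *: v + x)) (h *: 1 + 0)
     - (fun h : R => f (h *: v + x)) 0)).
  by rewrite funeqE => h /=; rewrite addr0 scale0r add0r [_%:A]mulr1.
by split=> -[d e]; split;
  move: d e; rewrite /derivable /derive /= E.
Qed.

Lemma is_derive_comp_line (F : R -> R) p x v (dF dp : R) :
  is_derive (p x) 1 F dF -> is_derive x v p dp ->
  is_derive x v (F \o p) (dF * dp).
Proof.
move=> HF /is_derive_line Hp; apply/is_derive_line.
have HF' : is_derive ((fun h : R => p (h *: v + x)) 0) 1 F dF.
  by rewrite scale0r add0r.
exact: (@is_derive1_comp _ F (fun h : R => p (h *: v + x))).
Qed.

Lemma class_C_cont k f : class_C k f -> continuous f.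
Proof. by case: k => [|k] []. Qed.

Lemma class_C_derivable k f i x :
  class_C k.+1 f -> derivable f x (basis_vec R i).
Proof. by move=> [_ /(_ i)[]]. Qed.

Lemma class_C_partial k f i : class_C k.+1 f -> class_C k (partial i f).
Proof. by move=> [_ /(_ i)[]]. Qed.

Lemma class_C_is_derive k f i x : class_C k.+1 f ->
  is_derive x (basis_vec R i) f (partial i f x).
Proof. by move=> /class_C_derivable H; apply/derivableP/H. Qed.

Lemma class_CW k f : class_C k.+1 f -> class_C k f.
Proof.
elim: k f => [|k IH] f Hf; first by split=> //; exact: class_C_cont Hf.
split; first exact: class_C_cont Hf.
move=> i; split; first by move=> x; exact: class_C_derivable Hf.
exact/IH/class_C_partial.
Qed.

(** Smoothness is proved by exhibiting a formula for each partial derivative, to which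
an induction hypothesis on k applies. *)
Lemma class_C_intro k f (df : 'I_2 -> R * R -> R) : continuous f ->
  (forall i x, is_derive x (basis_vec R i) f (df i x)) ->
  (forall i, class_C k (df i)) -> class_C k.+1 f.
Proof.
move=> cf dfi Hdf; split=> // i; split; first by move=> x; case: (dfi i x).
suff -> : partial i f = df i by [].
by apply/funext => x; rewrite /partial; case: (dfi i x).
Qed.

Lemma partialE f i x (df : R) :
  is_derive x (basis_vec R i) f df -> partial i f x = df.
Proof. by case. Qed.

Lemma class_C_cst k (c : R) : class_C k (fun _ : R * R => c).
Proof.
elim: k c => [|k IH] c; first by split=> //; exact: cst_continuous.
apply: (@class_C_intro _ _ (fun _ _ => 0 : R)).
- exact: cst_continuous.
- by move=> i; exact: (IH 0).
Qed.

Lemma continuous_add f g : continuous f -> continuous g ->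
  continuous (fun x => f x + g x).
Proof. move=> cf cg x; exact: (cvgD (cf x) (cg x)). Qed.

Lemma continuous_mul f g : continuous f -> continuous g ->
  continuous (fun x => f x * g x).
Proof. move=> cf cg x; exact: (cvgM (cf x) (cg x)). Qed.

Lemma class_CD k f g : class_C k f -> class_C k g ->
  class_C k (fun x => f x + g x).
Proof.
elim: k f g => [|k IH] f g Hf Hg.
  split=> //; apply: continuous_add; first exact: class_C_cont Hf.
  exact: class_C_cont Hg.
apply: (@class_C_intro _ _ (fun i x => partial i f x + partial i g x)).
- by apply: continuous_add; [exact: class_C_cont Hf|exact: class_C_cont Hg].
- move=> i x; apply: is_deriveD; [exact: class_C_is_derive Hf|].
  exact: class_C_is_derive Hg.
- by move=> i; apply: IH; exact: class_C_partial.
Qed.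

Lemma is_derive_mul f g x v (df dg : R) :
  is_derive x v f df -> is_derive x v g dg ->
  is_derive x v (fun y => f y * g y) (df * g x + f x * dg).
Proof.
move=> Hf Hg; apply: (is_derive_eq (is_deriveM Hf Hg)).
by rewrite addrC /GRing.scale /= [g x * _]mulrC.
Qed.

Lemma class_CM k f g : class_C k f -> class_C k g ->
  class_C k (fun x => f x * g x).
Proof.
elim: k f g => [|k IH] f g Hf Hg.
  split=> //; apply: continuous_mul; first exact: class_C_cont Hf.
  exact: class_C_cont Hg.
apply: (@class_C_intro _ _ (fun i x => partial i f x * g x + f x * partial i g x)).
- by apply: continuous_mul; [exact: class_C_cont Hf|exact: class_C_cont Hg].
- move=> i x; apply: is_derive_mul; [exact: class_C_is_derive Hf|].
  exact: class_C_is_derive Hg.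
- move=> i; apply: class_CD; apply: IH; try exact: class_C_partial;
    exact: class_CW.
Qed.

Lemma is_derive_component j x v :
  is_derive x v (@component R j) (component j v).
Proof.
apply/is_derive_line.
have -> : (fun h : R => component j (h *: v + x)) =
          (fun h : R => h * component j v + component j x).
  by apply/funext => h; rewrite /component; case: ifP.
by apply: is_derive_eq; rewrite ?addr0 /= /GRing.scale /= ?mulr0 ?add0r ?mulr1.
Qed.

Lemma continuous_component j : continuous (@component R j).
Proof.
move=> x; rewrite /component; case: (j == 0); [exact: cvg_fst|exact: cvg_snd].
Qed.

Lemma component_basis i j : component j (basis_vec R i) = (i == j)%:R.
Proof.
rewrite /component /basis_vec.
by case: i => [[|[|//]] ?]; case: j => [[|[|//]] ?].
Qed.

Lemma partial_component i j x : partial i (@component R j) x = (i == j)%:R.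
Proof.
by apply: partialE; rewrite -component_basis; exact: is_derive_component.
Qed.

Lemma smooth_component j : smooth (@component R j).
Proof.
case=> [|k]; first by split=> //; exact: continuous_component.
apply: (@class_C_intro _ _ (fun i _ => (i == j)%:R)).
- exact: continuous_component.
- move=> i x; rewrite -component_basis; exact: is_derive_component.
- move=> i; exact: class_C_cst.
Qed.

Lemma smooth_cst (c : R) : smooth (fun _ : R * R => c).
Proof. by move=> k; exact: class_C_cst. Qed.

Lemma smoothD f g : smooth f -> smooth g -> smooth (fun x => f x + g x).
Proof. by move=> Hf Hg k; apply: class_CD. Qed.

Lemma smoothM f g : smooth f -> smooth g -> smooth (fun x => f x * g x).
Proof. by move=> Hf Hg k; apply: class_CM. Qed.

Lemma smoothB f g : smooth f -> smooth g -> smooth (fun x => f x - g x).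
Proof.
move=> Hf Hg; have -> : (fun x => f x - g x) = (fun x => f x + (-1) * g x).
  by apply/funext => x; rewrite mulN1r.
by apply: smoothD => //; apply: smoothM => //; exact: smooth_cst.
Qed.

Lemma smooth_partial f i : smooth f -> smooth (partial i f).
Proof. by move=> Hf k; exact: class_C_partial (Hf k.+1). Qed.

Lemma smooth_cont f : smooth f -> continuous f.
Proof. by move=> /(_ 0%N) []. Qed.

Lemma smooth_is_derive f i x : smooth f ->
  is_derive x (basis_vec R i) f (partial i f x).
Proof. by move=> Hf; apply: (@class_C_is_derive 0); exact: Hf. Qed.

Lemma partialB f g i x : smooth f -> smooth g ->
  partial i (fun y => f y - g y) x = partial i f x - partial i g x.
Proof.
move=> Hf Hg; apply: partialE.
by apply: is_deriveB; [exact: smooth_is_derive Hf|exact: smooth_is_derive Hg].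
Qed.

Lemma partialM f g i x : smooth f -> smooth g ->
  partial i (fun y => f y * g y) x = partial i f x * g x + f x * partial i g x.
Proof.
move=> Hf Hg; apply: partialE.
by apply: is_derive_mul; [exact: smooth_is_derive Hf|exact: smooth_is_derive Hg].
Qed.

Lemma is_derive_slice0 f (y t : R) : smooth f ->
  is_derive t 1 (fun s : R => f (s, y)) (partial 0 f (t, y)).
Proof.
move=> Hf; have /is_derive_line H := @smooth_is_derive f 0 (t, y) Hf.
apply/is_derive_line.
suff -> : (fun h : R => f (h *: 1 + t, y)) =
          (fun h : R => f (h *: basis_vec R 0 + (t, y))) by [].
apply/funext => h; congr f; rewrite /basis_vec /=.
by congr pair; rewrite /= /GRing.scale /= mulr0 add0r.
Qed.

Lemma is_derive_slice1 f (y t : R) : smooth f ->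
  is_derive t 1 (fun s : R => f (y, s)) (partial 1 f (y, t)).
Proof.
move=> Hf; have /is_derive_line H := @smooth_is_derive f 1 (y, t) Hf.
apply/is_derive_line.
suff -> : (fun h : R => f (y, h *: 1 + t)) =
          (fun h : R => f (h *: basis_vec R 1 + (y, t))) by [].
apply/funext => h; congr f; rewrite /basis_vec /=.
by congr pair; rewrite /= /GRing.scale /= mulr0 add0r.
Qed.

End SmoothCalculus.

(** * Equality of mixed partial derivatives *)

Section Schwarz.
Variable R : realType.
Implicit Types (f g : R * R -> R).

Lemma MVT_interior (F dF : R -> R) (a h : R) : 0 < h ->
  (forall s : R, is_derive s 1 F (dF s)) ->
  exists2 c : R, a < c < a + h & F (a + h) - F a = h * dF c.
Proof.
move=> h0 HF.
have ah : a < a + h by rewrite ltrDl.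
have [|c] := @MVT R F dF a (a + h) ah (fun x _ => HF x).
- apply: derivable_within_continuous => x _; by case: (HF x).
- rewrite in_itv /= => Hc E; exists c => //.
  by rewrite E [a + h]addrC addrK mulrC.
Qed.

(** The second difference of f over the square of corner (a, b) and side h, divided
by h^2, is a value of either mixed derivative: apply the mean value theorem in
one variable and then in the other, in both orders. *)
Lemma second_difference f (a b h : R) : smooth f -> 0 < h ->
  exists xi eta xi' eta' : R,
  [/\ a < xi < a + h, b < eta < b + h, a < xi' < a + h, b < eta' < b + h &
    partial 1 (partial 0 f) (xi, eta) = partial 0 (partial 1 f) (xi', eta')].
Proof.
move=> Hf h0.
have H0 := fun i => smooth_partial i Hf.
have D0 (s : R) : is_derive s 1 (fun s => f (s, b + h) - f (s, b))
   (partial 0 f (s, b + h) - partial 0 f (s, b)).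
  by apply: is_deriveB; exact: is_derive_slice0.
have D1 (s : R) : is_derive s 1 (fun s => f (a + h, s) - f (a, s))
   (partial 1 f (a + h, s) - partial 1 f (a, s)).
  by apply: is_deriveB; exact: is_derive_slice1.
have [xi Hxi E1] := MVT_interior a h0 D0.
have [eta' Heta' E2] := MVT_interior b h0 D1.
have [eta Heta E3] := MVT_interior b h0 (fun s => is_derive_slice1 xi s (H0 0)).
have [xi' Hxi' E4] := MVT_interior a h0 (fun s => is_derive_slice0 eta' s (H0 1)).
exists xi, eta, xi', eta'; split; [by []|by []|by []|by []|].
rewrite E3 in E1; rewrite E4 in E2.
have hh : h * h != 0 by rewrite mulf_neq0 // gt_eqF.
apply: (mulfI hh); rewrite -[LHS]mulrA -[RHS]mulrA -E1 -E2.
by move: (f (a + h, b + h)) (f (a + h, b)) (f (a, b + h)) (f (a, b)) => *; ring.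
Qed.

(** The box lies above and to the right of (a, b), like the points given by the mean
value theorem.  Smaller sides h' are allowed so that two boxes can be shrunk to
a common one. *)
Lemma continuous_box f (a b e : R) : continuous f -> 0 < e ->
  exists2 h : R, 0 < h & forall s t h' : R, h' <= h ->
    a < s < a + h' -> b < t < b + h' -> `|f (a, b) - f (s, t)| < e.
Proof.
move=> cf e0; have /cvgrPdist_lt /(_ e e0) := cf (a, b).
move=> /nbhs_ballP [h /= h0 H]; exists h => // s t h' h'h /andP[s1 s2] /andP[t1 t2].
have s3 : s - a < h by rewrite ltrBlDl; apply: lt_le_trans s2 _; rewrite lerD2l.
have t3 : t - b < h by rewrite ltrBlDl; apply: lt_le_trans t2 _; rewrite lerD2l.
by apply: H; split; rewrite /ball /= distrC gtr0_norm ?subr_gt0.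
Qed.

Lemma Schwarz f : smooth f -> partial 1 (partial 0 f) = partial 0 (partial 1 f).
Proof.
move=> Hf; apply/funext => -[a b]; apply/eqP; rewrite -subr_eq0 -normr_eq0.
apply/negP => /negP; rewrite neq_lt ltNge normr_ge0 /=.
set e := `|_| => e0.
have e2 : 0 < e / 2 by rewrite divr_gt0.
have c i j : continuous (partial i (partial j f)).
  by apply: smooth_cont; do 2 apply: smooth_partial.
have [h1 h10 H1] := continuous_box a b (c 1 0) e2.
have [h2 h20 H2] := continuous_box a b (c 0 1) e2.
have h0 : 0 < Num.min h1 h2 by rewrite lt_min h10 h20.
have [xi [eta [xi' [eta' [A1 A2 A3 A4 E]]]]] := second_difference a b Hf h0.
have m1 : Num.min h1 h2 <= h1 by rewrite ge_min lexx.
have m2 : Num.min h1 h2 <= h2 by rewrite ge_min lexx orbT.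
have B1 : `|partial 1 (partial 0 f) (a, b)
    - partial 1 (partial 0 f) (xi, eta)| < e / 2.
  exact: H1 m1 A1 A2.
have B2 : `|partial 0 (partial 1 f) (a, b)
    - partial 0 (partial 1 f) (xi', eta')| < e / 2.
  exact: H2 m2 A3 A4.
suff : e < e by rewrite ltxx.
have := ltrD B1 B2; rewrite -splitr; apply: le_lt_trans.
rewrite /e [X in _ <= _ + X]distrC E; apply: le_trans (ler_normD _ _).
by rewrite addrA subrK.
Qed.

End Schwarz.

(** * The function exp (- 1 / s) *)

Section Bump.
Variable R : realType.

(** s^-m exp (- 1 / s), extended by 0.  Differentiation maps the span of these
functions to itself, so the smoothness of exp (- 1 / s) is proved for all m at
once. *)
Definition flat (m : nat) (s : R) : R :=
  if 0 < s then s^-1 ^+ m * expR (- s^-1) else 0.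

Lemma flat_ge0 m s : 0 <= flat m s.
Proof.
rewrite /flat; case: ifP => // s0.
by rewrite mulr_ge0 ?expR_ge0// exprn_ge0// invr_ge0 ltW.
Qed.

(** This is exp t >= t^(m+2) / (m+2)! at t = 1 / s.  The factor s^2 is what makes
the derivative at 0 exist and vanish. *)
Lemma flat_le m s : flat m s <= m.+2`!%:R * s ^+ 2.
Proof.
rewrite /flat; case: ifP => s0; last by rewrite mulr_ge0 ?sqr_ge0.
have t0 : 0 < s^-1 by rewrite invr_gt0.
have := expR_ge1Dxn m.+1 (ltW t0); set t := s^-1 in t0 *.
have -> : s = t^-1 by rewrite invrK.
have f0 : 0 < m.+2`!%:R :> R by rewrite ltr0n fact_gt0.
move=> H; rewrite expRN ler_pdivrMr ?expR_gt0// -mulrA mulrC.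
have H' : t ^+ m.+2 / m.+2`!%:R <= expR t by lra.
have {}H' : t ^+ m.+2 <= expR t * m.+2`!%:R by rewrite -ler_pdivrMr.
have -> : t ^+ m = t^-1 ^+ 2 * t ^+ m.+2.
  by rewrite -(addn2 m) exprD exprVn mulrCA mulVf ?mulr1 // expf_neq0 // gt_eqF.
rewrite [X in _ <= X](_ : _ = t^-1 ^+ 2 * (expR t * m.+2`!%:R)); last by ring.
by rewrite ler_wpM2l ?sqr_ge0.
Qed.

Lemma is_derive_flat m (s : R) :
  is_derive s 1 (flat m) (- m%:R * flat m.+1 s + flat m.+2 s).
Proof.
have [s0|s0|<-] := ltgtP 0 s.
- have d1 : is_derive s 1 (fun y : R => y^-1) (- (s ^- 2)).
    split; first by apply: derivableV => //; rewrite ?gt_eqF.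
    rewrite deriveV ?gt_eqF// derive_id; exact: mulr1.
  have d2 : is_derive s 1 (fun y : R => expR (- y^-1)) (expR (- s^-1) * s ^- 2).
    apply: (is_derive1_comp (f := expR)).
    by apply: (is_derive_eq (is_deriveN d1)); rewrite opprK.
  have d3 : is_derive s 1 (fun y : R => y^-1 ^+ m) (m%:R * s^-1 ^+ m.-1 * - s ^- 2).
    have -> : (fun y : R => y^-1 ^+ m) = (fun y : R => y^-1) ^+ m.
      by apply/funext => y; rewrite exprfctE.
    exact: is_deriveX.
  have d4 := is_deriveM d3 d2.
  apply: (@near_eq_is_derive _ _ _ (fun y : R => y^-1 ^+ m * expR (- y^-1))).
    by near=> y; rewrite /flat ifT //; near: y; exact: lt_nbhsr.
  apply: (is_derive_eq d4).
  rewrite /flat s0 /GRing.scale /= -exprVn !exprS.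
  case: (m) => [|n] /=; first by rewrite expr0; ring.
  by rewrite !exprS; ring.
- have -> : - m%:R * flat m.+1 s + flat m.+2 s = 0.
    by rewrite /flat ltNge (ltW s0) /= mulr0 addr0.
  apply: (@near_eq_is_derive _ _ _ (cst 0)).
  near=> y; rewrite /flat ltNge ifF //; apply/negbTE; rewrite negbK ltW //.
  near: y; exact: lt_nbhsl.
- have -> : - m%:R * flat m.+1 0 + flat m.+2 0 = 0.
    by rewrite /flat !ltxx mulr0 addr0.
  have H : h^-1 *: (flat m (h *: 1 + 0) - flat m 0) @[h --> (0 : R)^'] --> (0 : R).
    apply/cvgr0Pnorm_lt => e e0.
    have f0 : 0 < m.+2`!%:R :> R by rewrite ltr0n fact_gt0.
    near=> h.
    have h0 : h != 0 by near: h; exact: nbhs_dnbhs_neq.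
    rewrite {2}/flat ltxx subr0 addr0 [h *: 1]mulr1 normrM normfV.
    rewrite [`|flat _ _|]ger0_norm ?flat_ge0 // ltr_pdivrMl ?normr_gt0 //.
    apply: (le_lt_trans (flat_le m h)).
    rewrite -real_normK ?num_real // expr2 mulrCA ltr_pM2l ?normr_gt0 //.
    rewrite -ltr_pdivlMl //.
    near: h; apply: dnbhs0_lt; by rewrite mulr_gt0 // invr_gt0.
  split; first by apply/cvg_ex; exists 0.
  exact/cvg_lim.
Unshelve. all: by end_near. Qed.

Lemma class_C_flat m k (p : R * R -> R) : smooth p -> class_C k (flat m \o p).
Proof.
move=> Hp; elim: k m => [|k IH] m.
  split=> // x; apply: continuous_comp; first exact: smooth_cont.
  apply/differentiable_continuous/derivable1_diffP.
  by case: (is_derive_flat m (p x)).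
apply: (@class_C_intro _ _ _ (fun i x =>
  (- m%:R * (flat m.+1 \o p) x + (flat m.+2 \o p) x) * partial i p x)).
- exact: class_C_cont (IH m).
- move=> i x; apply: is_derive_comp_line; first exact: is_derive_flat.
  exact: smooth_is_derive.
- move=> i; apply: class_CM; last exact: smooth_partial.
  apply: class_CD; last exact: IH.
  by apply: class_CM; [exact: class_C_cst|exact: IH].
Qed.

Lemma smooth_flat (p : R * R -> R) : smooth p -> smooth (flat 0 \o p).
Proof. by move=> Hp k; exact: class_C_flat. Qed.

Lemma flat0_le1 s : flat 0 s <= 1.
Proof.
rewrite /flat; case: ifP => // s0; rewrite expr0 mul1r.
by rewrite -expR0 ler_expR oppr_le0 invr_ge0 ltW.
Qed.

(** The shift c is 1 for the distance to the circle, where it keeps the supports of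
the approximations inside the disc, and 0 for half-planes. *)
Lemma flat0_cvg (s c : R) : 0 <= c ->
  flat 0 (k%:R * s - c) @[k --> \oo] --> ((0 < s)%R%:R : R).
Proof.
move=> c0; case: ltP => s0; last first.
  apply: cvg_near_cst; near=> n.
  rewrite /flat ltNge ifF //; apply/negbTE; rewrite negbK.
  by rewrite subr_le0; apply: le_trans c0; rewrite mulr_ge0_le0 // ler0n.
have ns_oo : (k%:R * s - c : R) @[k --> \oo] --> +oo.
  apply/cvgryPge => A; near=> n.
  rewrite lerBrDr -ler_pdivrMr //.
  by near: n; exact: nbhs_infty_ger.
have npos : \forall k \near \oo, 0 < (k%:R * s - c : R).
  near=> n.
  by rewrite subr_gt0 -ltr_pdivrMr //; near: n; exact: nbhs_infty_gtr.
have inv0 : ((k%:R * s - c)^-1 : R) @[k --> \oo] --> 0.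
  by apply/(gtr0_cvgV0 npos).
apply: (cvg_trans (G := expR (- (k%:R * s - c)^-1) @[k --> \oo])).
  apply: near_eq_cvg; near=> n.
  by rewrite /flat ifT ?expr0 ?mul1r //; near: n.
have -> : (true%:R : R) = expR (- 0) by rewrite oppr0 expR0.
apply: continuous_cvg; first exact: continuous_expR.
exact: cvgN.
Unshelve. all: by end_near. Qed.

End Bump.

(** * Measure and integration on the disc *)

Section PlaneMeasure.
Variable R : realType.
Local Notation plane := (measurableTypeR R * measurableTypeR R)%type.
Local Notation leb := (@lebesgue_measure R).
Local Notation disc := (@unit_ball R).
Implicit Types (f : R * R -> R).

(** An open set is the union of the countably many boxes with rational centre and
side 2 / (n + 1) that it contains. *)
Lemma open_measurable_plane (U : set (R * R)) :
  open U -> measurable (U : set plane).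
Proof.
move=> oU.
pose box (q : rat * rat * nat) : set (R * R) :=
  `](ratr q.1.1 - q.2.+1%:R^-1), (ratr q.1.1 + q.2.+1%:R^-1)[%classic `*`
  `](ratr q.1.2 - q.2.+1%:R^-1), (ratr q.1.2 + q.2.+1%:R^-1)[%classic.
pose F (q : rat * rat * nat) : set plane :=
  if `[< box q `<=` U >] then box q else set0.
have -> : U = \bigcup_q F q.
  apply/seteqP; split=> [[a b] Uab|x [q _]]; last first.
    by rewrite /F; case: asboolP => // H /H.
  have /nbhs_ballP [e /= e0 He] : nbhs (a, b) U by exact: open_nbhs_nbhs.
  have [n Hn] : exists n : nat, n.+1%:R^-1 < e / 2.
    exists (Num.truncn (e / 2)^-1).
    rewrite invf_plt ?posrE ?divr_gt0 //; exact: Num.Theory.truncnS_gt.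
  have [d dE] : exists d : R, d = n.+1%:R^-1 by eexists.
  have d0 : 0 < d by rewrite dE invr_gt0.
  rewrite -dE in Hn.
  have [q1 /[!in_itv]/= /andP[q1l q1r]] : exists q, ratr q \in `](a - d), (a + d)[.
    by apply: rat_in_itvoo; lra.
  have [q2 /[!in_itv]/= /andP[q2l q2r]] : exists q, ratr q \in `](b - d), (b + d)[.
    by apply: rat_in_itvoo; lra.
  exists (q1, q2, n) => //; rewrite /F asboolT.
    by split; rewrite /= -dE in_itv /=; lra.
  move=> [x y] [/=]; rewrite -dE !in_itv /= => /andP[x1 x2] /andP[y1 y2].
  by apply: He; split; rewrite /ball /= ltr_norml; lra.
apply: countable_bigcupT_measurable => // q; rewrite /F; case: asboolP => // _.
by apply: measurableX; exact: measurable_itv.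
Qed.

Lemma continuous_measurable_plane f :
  continuous f -> measurable_fun (setT : set plane) (f : plane -> R).
Proof.
move=> /continuousP cf; apply: (measurability _ (RGenOpens.measurableE R)).
move=> _ [_ [a [b ->] <-]]; rewrite setTI; apply: open_measurable_plane.
exact/cf/interval_open.
Qed.

Lemma open_unit_ball : open disc.
Proof.
have -> : disc =
    (fun x => x.1 * x.1 + x.2 * x.2) @^-1` `]-oo, 1[.
  by apply/seteqP; split=> x /=; rewrite in_itv.
apply: open_comp; last exact: interval_open.
have c1 : continuous (fun x : R * R => x.1) by move=> x; exact: cvg_fst.
have c2 : continuous (fun x : R * R => x.2) by move=> x; exact: cvg_snd.
by move=> x _; apply: continuous_add; exact: continuous_mul.
Qed.

Lemma measurable_unit_ball : measurable (disc : set plane).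
Proof. by apply: open_measurable_plane; exact: open_unit_ball. Qed.

Lemma unit_ball_box (x : R * R) : unit_ball x -> `|x.1| <= 1 /\ `|x.2| <= 1.
Proof.
rewrite /unit_ball /= => H.
by split; rewrite ler_norml; apply/andP; split; nra.
Qed.

Lemma unit_ball_area : (area R disc < +oo)%E.
Proof.
pose sq : set plane := `[(-1 : R), 1]%classic `*` `[(-1 : R), 1]%classic.
have msq : measurable sq by apply: measurableX; exact: measurable_itv.
apply: (@le_lt_trans _ _ (area R sq)).
  apply: le_measure; rewrite ?inE //; first exact: measurable_unit_ball.
  move=> x /unit_ball_box [x1 x2]; split => /=; by rewrite in_itv /= -ler_norml.
pose J : set (measurableTypeR R) := `[(-1 : R), 1]%classic.
have -> : area R sq = (leb J * leb J)%E.
  by apply: product_measure1E; exact: measurable_itv.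
rewrite /J lebesgue_measure_itv /= lte_fin ifT; last by lra.
by rewrite -EFinB -EFinM ltry.
Qed.

Lemma continuous_bounded_unit_ball f : continuous f ->
  exists M : R, forall x, unit_ball x -> `|f x| <= M.
Proof.
move=> cf; pose sq : set (R * R) := `[(-1 : R), 1]%classic `*` `[(-1 : R), 1]%classic.
have csq : compact sq by apply: compact_setX; exact: segment_compact.
have : compact (f @` sq).
  by apply: continuous_compact => //; exact: continuous_subspaceT.
move=> /compact_bounded [M [_ /(_ (M + 1))]]; rewrite ltrDl ltr01 => /(_ isT) HM.
exists (M + 1) => x /unit_ball_box [x1 x2]; apply: HM; exists x => //.
by split => /=; rewrite in_itv /= -ler_norml.
Qed.

Lemma continuous_integrable_ball f : continuous f ->
  (area R).-integrable disc (EFin \o f).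
Proof.
move=> cf; apply: measurable_bounded_integrable.
- exact: measurable_unit_ball.
- exact: unit_ball_area.
- by apply: (measurable_funS measurableT) => //; exact: continuous_measurable_plane.
- have [M HM] := continuous_bounded_unit_ball cf.
  exists M; split; first exact: num_real.
  by move=> y My x /HM /le_trans; apply; exact: ltW.
Qed.

Lemma continuous_L2_ball f : continuous f -> in_L2 (area R) disc f.
Proof.
move=> cf; split.
  by apply: (measurable_funS measurableT) => //; exact: continuous_measurable_plane.
have cf2 : continuous (fun x => f x ^+ 2).
  by under eq_fun do rewrite expr2; exact: continuous_mul.
have /integrableP[_] := continuous_integrable_ball cf2.
apply: le_lt_trans; rewrite /sqL2norm; apply: le_trans (lee_abs _) _.
apply: le_abse_integral; first exact: measurable_unit_ball.
apply/measurable_EFinP/(measurable_funS measurableT) => //.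
exact: continuous_measurable_plane.
Qed.

End PlaneMeasure.

(** * Integrals over the circle *)

Section OneDimensional.
Variable R : realType.
Local Notation leb := (@lebesgue_measure R).
Implicit Types (f g F : R -> R).

Lemma continuous_integrable_itv f (a b : R) : continuous f ->
  leb.-integrable `[a, b] (EFin \o f).
Proof.
move=> cf; apply: continuous_compact_integrable; first exact: segment_compact.
exact: continuous_subspaceT.
Qed.

Lemma Rintegral_split f (a b c : R) : continuous f -> a <= b -> b <= c ->
  \int[leb]_(t in `[a, c]) f t =
  \int[leb]_(t in `[a, b]) f t + \int[leb]_(t in `[b, c]) f t.
Proof.
move=> cf ab bc.
have H := @Rintegral_itvB R f (BLeft a) (BRight c) b
  (continuous_integrable_itv a c cf).
rewrite !bnd_simp in H.
rewrite -(@Rintegral_itv_obnd_cbnd R b (BRight c)).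
  by rewrite -H // addrC subrK.
apply: (integrableS _ _ _ (continuous_integrable_itv b c cf)) => //.
by apply: subset_itvr; rewrite bnd_simp.
Qed.

Lemma Rintegral_FTC2 f F (a b : R) : a <= b -> continuous f ->
  (forall t, a <= t <= b -> is_derive t 1 F (f t)) ->
  \int[leb]_(t in `[a, b]) f t = F b - F a.
Proof.
rewrite le_eqVlt => /predU1P[->|ab] cf HF.
  by rewrite set_itv1 Rintegral_set1 subrr.
have cF t : a <= t <= b -> {for t, continuous F}.
  by move=> /HF [d _]; exact/differentiable_continuous/derivable1_diffP.
rewrite /Rintegral (@continuous_FTC2 _ f F) //.
- exact: continuous_subspaceT.
- split.
  + by move=> t; rewrite in_itv /= => /andP[? ?]; case: (HF t) => //; rewrite !ltW.
  + by apply: cvg_at_right_filter; apply: cF; rewrite lexx ltW.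
  + by apply: cvg_at_left_filter; apply: cF; rewrite lexx ltW.
- move=> t; rewrite in_itv /= => /andP[? ?]; rewrite derive1E.
  by case: (HF t) => //; rewrite !ltW.
Qed.

Lemma antiderivative g : continuous g ->
  exists G : R -> R, forall y : R, `|y| <= 1 -> is_derive y 1 G (g y).
Proof.
(* Starting at -2 rather than -1 makes -1 an interior point. *)
move=> cg; exists (fun y => \int[leb]_(t in `[(-2), y]) g t) => y.
rewrite ler_norml => /andP[y1 _]; have ay : -2 < y by lra.
have y2 : y < y + 1 by rewrite ltrDl.
have int2 := continuous_integrable_itv (-2) (y + 1) cg.
have [d e] := continuous_FTC1_closed y2 int2 ay (cg y).
by split; [exact: d|rewrite -derive1E; exact: e].
Qed.

(** Substitution by means of the antiderivative G \o F: F can be a sine or a cosine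
over any arc. *)
Lemma Rintegral_comp g G F f (a b : R) : a <= b -> continuous g -> continuous f ->
  (forall t : R, is_derive t 1 F (f t)) -> (forall t, `|F t| <= 1) ->
  (forall y : R, `|y| <= 1 -> is_derive y 1 G (g y)) ->
  \int[leb]_(t in `[a, b]) (g (F t) * f t) = G (F b) - G (F a).
Proof.
move=> ab cg cf HF F1 HG; apply: (Rintegral_FTC2 (F := G \o F)) => //.
- move=> t; apply: cvgM; last exact: cf.
  apply: continuous_comp; last exact: cg.
  by apply/differentiable_continuous/derivable1_diffP; case: (HF t).
- by move=> t _; apply: is_derive1_comp; apply: HG.
Qed.

Lemma cos_le0 (t : R) : pi / 2 <= t <= 3 * (pi / 2) -> cos t <= 0.
Proof.
move=> /andP[t1 t2]; have -> : t = (t - pi) + pi by rewrite subrK.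
rewrite cosDpi oppr_le0; apply: cos_ge0_pihalf; apply/andP; split; lra.
Qed.

Lemma cos_ge0_last (t : R) : 3 * (pi / 2) <= t <= 2 * pi -> 0 <= cos t.
Proof.
move=> /andP[t1 t2]; have -> : t = (t - pi) + pi by rewrite subrK.
rewrite cosDpi oppr_ge0; apply: cos_le0; apply/andP; split; lra.
Qed.

Lemma sin_le0 (t : R) : pi <= t <= 2 * pi -> sin t <= 0.
Proof.
move=> /andP[t1 t2]; have -> : t = (t - pi) + pi by rewrite subrK.
rewrite sinDpi oppr_le0; apply: sin_ge0_pi; apply/andP; split; lra.
Qed.

Lemma sqrt_1Bsin2 (t : R) : Num.sqrt (1 - sin t ^+ 2) = `|cos t|.
Proof. by rewrite -(cos2Dsin2 t) addrK sqrtr_sqr. Qed.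

Lemma sqrt_1Bcos2 (t : R) : Num.sqrt (1 - cos t ^+ 2) = `|sin t|.
Proof. by rewrite -(cos2Dsin2 t) addrAC subrr add0r sqrtr_sqr. Qed.

Lemma norm_sin_le1 (t : R) : `|sin t| <= 1.
Proof. by rewrite ler_norml sin_le1 sin_geN1. Qed.

Lemma norm_cos_le1 (t : R) : `|cos t| <= 1.
Proof. by rewrite ler_norml cos_le1 cos_geN1. Qed.

Lemma sin_3pihalf : sin (3 * (pi / 2)) = -1 :> R.
Proof.
have -> : 3 * (pi / 2) = pi / 2 + pi :> R by lra.
by rewrite sinDpi sin_pihalf.
Qed.

End OneDimensional.

Section CircleIntegrals.
Variable R : realType.
Local Notation leb := (@lebesgue_measure R).
Implicit Types (f : R * R -> R).

Definition chord (y : R) : R := Num.sqrt (1 - y ^+ 2).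

Lemma continuous_chord : continuous chord.
Proof.
move=> y; apply: continuous_comp; last exact: sqrt_continuous.
by apply: (@cvgB _ R^o); [exact: cvg_cst|exact: exprn_continuous].
Qed.

Lemma continuous_slices f (p q : R -> R) : continuous f -> continuous p ->
  continuous q -> continuous (fun y => f (p y, q y)).
Proof.
move=> cf cp cq y; apply: (@continuous_comp _ _ _ (fun y => (p y, q y)) f).
  exact: (cvg_pair (cp y) (cq y)).
exact: cf.
Qed.

Lemma continuous_circle f : continuous f -> continuous (f \o @circle_point R).
Proof.
move=> cf; apply: continuous_slices => //; first exact: continuous_cos.
exact: continuous_sin.
Qed.

(** Put y = sin t.  The right half of the circle is run upwards in the first and in
the last quarter of the period, the left half downwards in between. *)
Lemma circle_integral_cos f : continuous f ->
  \int[leb]_(t in `[0, 2 * pi]) (f (circle_point t) * cos t) =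
  \int[leb]_(y in `[(-1), 1]) (f (chord y, y) - f (- chord y, y)).
Proof.
move=> cf; have pi0 : 0 < pi :> R := pi_gt0 R.
have cid : continuous (fun y : R => y) by move=> y; exact: cvg_id.
have cN : continuous (fun y => - chord y).
  by move=> y; apply: cvgN; exact: continuous_chord.
have cp : continuous (fun y => f (chord y, y)).
  by apply: continuous_slices => //; exact: continuous_chord.
have cm : continuous (fun y => f (- chord y, y)) by exact: continuous_slices.
have [Gp HGp] := antiderivative cp.
have [Gm HGm] := antiderivative cm.
have cF : continuous (fun t : R => f (circle_point t) * cos t).
  move=> t; apply: cvgM; [exact: (continuous_circle cf)|exact: continuous_cos].
have [p0 p1 p2] : [/\ 0 <= pi / 2 :> R, pi / 2 <= 3 * (pi / 2) :> R
    & 3 * (pi / 2) <= 2 * pi :> R] by split; lra.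
rewrite (Rintegral_split cF p0 (le_trans p1 p2)) (Rintegral_split cF p1 p2).
have dsin := @is_derive_sin R.
rewrite [X in X + _](_ : _ = Gp (sin (pi / 2)) - Gp (sin 0));
    last first.
  rewrite -(Rintegral_comp p0 cp (@continuous_cos R) dsin (@norm_sin_le1 R) HGp).
  apply: eq_Rintegral => t; rewrite inE /= in_itv /= => /andP[t0 t1].
  rewrite /chord sqrt_1Bsin2 ger0_norm //.
  by apply: cos_ge0_pihalf; apply/andP; split => //; lra.
rewrite [X in _ + (X + _)](_ : _ = Gm (sin (3 * (pi / 2))) - Gm (sin (pi / 2)));
    last first.
  rewrite -(Rintegral_comp p1 cm (@continuous_cos R) dsin (@norm_sin_le1 R) HGm).
  apply: eq_Rintegral => t; rewrite inE /= in_itv /= => t0.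
  by rewrite /chord sqrt_1Bsin2 ler0_norm ?opprK // cos_le0.
rewrite [X in _ + (_ + X)](_ : _ = Gp (sin (2 * pi)) - Gp (sin (3 * (pi / 2))));
    last first.
  rewrite -(Rintegral_comp p2 cp (@continuous_cos R) dsin (@norm_sin_le1 R) HGp).
  apply: eq_Rintegral => t; rewrite inE /= in_itv /= => t0.
  by rewrite /chord sqrt_1Bsin2 ger0_norm // cos_ge0_last.
have D (y : R) : -1 <= y <= 1 ->
    is_derive y 1 (fun y => Gp y - Gm y) (f (chord y, y) - f (- chord y, y)).
  by rewrite -ler_norml => y1; apply: is_deriveB; [exact: HGp|exact: HGm].
have cD : continuous (fun y => f (chord y, y) - f (- chord y, y)).
  by move=> y; apply: (@cvgB _ R^o); [exact: cp|exact: cm].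
have m11 : -1 <= 1 :> R by lra.
rewrite (Rintegral_FTC2 m11 cD D).
rewrite sin_pihalf sin_3pihalf sin0 [2 * pi]mulr_natl sin2pi; ring.
Qed.

(** Put x = cos t.  The upper half of the circle is run leftwards for t <= pi, and
the lower half rightwards afterwards. *)
Lemma circle_integral_sin f : continuous f ->
  \int[leb]_(t in `[0, 2 * pi]) (f (circle_point t) * sin t) =
  \int[leb]_(x in `[(-1), 1]) (f (x, chord x) - f (x, - chord x)).
Proof.
move=> cf; have pi0 : 0 < pi :> R := pi_gt0 R.
have cid : continuous (fun y : R => y) by move=> y; exact: cvg_id.
have cN : continuous (fun y => - chord y).
  by move=> y; apply: cvgN; exact: continuous_chord.
have cp : continuous (fun y => f (y, chord y)).
  by apply: continuous_slices => //; exact: continuous_chord.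
have cm : continuous (fun y => f (y, - chord y)) by exact: continuous_slices.
have [Gp HGp] := antiderivative cp.
have [Gm HGm] := antiderivative cm.
have cF : continuous (fun t : R => f (circle_point t) * sin t).
  move=> t; apply: cvgM; [exact: (continuous_circle cf)|exact: continuous_sin].
have [p0 p1] : 0 <= pi :> R /\ pi <= 2 * pi :> R by split; lra.
rewrite (Rintegral_split cF p0 p1).
have cS : continuous (fun t : R => - sin t).
  by move=> t; apply: cvgN; exact: continuous_sin.
have E (g : R -> R) (a b : R) : continuous g ->
    \int[leb]_(t in `[a, b]) (g (cos t) * sin t) =
    - \int[leb]_(t in `[a, b]) (g (cos t) * - sin t).
  move=> cg; rewrite -mulN1r -RintegralZl //; last first.
    apply: continuous_integrable_itv => t; apply: cvgM; last exact: cS.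
    by apply: continuous_comp; [exact: continuous_cos|exact: cg].
  by apply: eq_Rintegral => t _; ring.
rewrite [X in X + _](_ : _ = - (Gp (cos pi) - Gp (cos 0)));
    last first.
  rewrite -(Rintegral_comp p0 cp cS (@is_derive_cos R) (@norm_cos_le1 R) HGp).
  rewrite -(E _ _ _ cp).
  apply: eq_Rintegral => t; rewrite inE /= in_itv /= => t0.
  by rewrite /chord sqrt_1Bcos2 ger0_norm // sin_ge0_pi.
rewrite [X in _ + X](_ : _ = - (Gm (cos (2 * pi)) - Gm (cos pi)));
    last first.
  rewrite -(Rintegral_comp p1 cm cS (@is_derive_cos R) (@norm_cos_le1 R) HGm).
  rewrite -(E _ _ _ cm).
  apply: eq_Rintegral => t; rewrite inE /= in_itv /= => t0.
  by rewrite /chord sqrt_1Bcos2 ler0_norm ?opprK // sin_le0.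
have D (y : R) : -1 <= y <= 1 ->
    is_derive y 1 (fun y => Gp y - Gm y) (f (y, chord y) - f (y, - chord y)).
  by rewrite -ler_norml => y1; apply: is_deriveB; [exact: HGp|exact: HGm].
have cD : continuous (fun y => f (y, chord y) - f (y, - chord y)).
  by move=> y; apply: (@cvgB _ R^o); [exact: cp|exact: cm].
have m11 : -1 <= 1 :> R by lra.
rewrite (Rintegral_FTC2 m11 cD D).
rewrite cospi cos0 [2 * pi]mulr_natl cos2pi; ring.
Qed.

End CircleIntegrals.

(** * Green's formula on the disc *)

Section Green.
Variable R : realType.
Local Notation leb := (@lebesgue_measure R).
Local Notation disc := (@unit_ball R).
Local Notation plane := (measurableTypeR R * measurableTypeR R)%type.
Implicit Types (f : R * R -> R).

(** The slice of the disc at height y is the open interval with endpoints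
- chord y and chord y when |y| <= 1, and is empty otherwise. *)
Lemma chord_integral (F dF : R -> R) (y : R) : continuous dF ->
  (forall t : R, is_derive t 1 F (dF t)) ->
  (\int[leb]_x ((EFin \o dF) \_ [set x : R | (x ^+ 2 + y ^+ 2 < 1)%R]) x =
   (if y \in `[(-1)%R, 1%R]%classic then F (chord y) - F (- chord y) else 0)%R%:E)%E.
Proof.
move=> cF HF; rewrite -integral_mkcond.
have [y1|y1] := boolP (y \in `[(-1), 1]%classic); last first.
  rewrite [X in integral _ X](_ : _ = set0) ?integral_set0 //.
  apply/seteqP; split => // x /= xy; move/negP: y1; apply.
  by rewrite inE /= in_itv /=; apply/andP; split; nra.
have {}y1 : 0 <= 1 - y ^+ 2.
  by move: y1; rewrite inE /= in_itv /= => /andP[? ?]; nra.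
have -> : [set x : R | x ^+ 2 + y ^+ 2 < 1] = `]- chord y, chord y[%classic.
  apply/seteqP; split => x /=; rewrite in_itv /= -ltr_norml /chord.
    by move=> H; have x2 := sqr_ge0 x; rewrite -sqrtr_sqr ltr_sqrt; lra.
  rewrite -sqrtr_sqr => H.
  have : x ^+ 2 < 1 - y ^+ 2; last by lra.
  by rewrite ltNge; apply/negP => /ler_wsqrtr; rewrite leNgt H.
have mF (I : interval R) : measurable_fun [set` I] (EFin \o dF).
  apply/measurable_EFinP; apply: (measurable_funS measurableT) => //.
  exact: continuous_measurable_fun.
rewrite integral_itv_bndo_bndc // integral_itv_obnd_cbnd //.
have c0 : - chord y <= chord y.
  by apply: (@le_trans _ _ 0); rewrite ?oppr_le0 /chord sqrtr_ge0.
rewrite -(Rintegral_FTC2 c0 cF (fun t _ => HF t)) /Rintegral fineK //.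
apply: integrable_fin_num => //.
exact: continuous_integrable_itv.
Qed.

Lemma continuous_slice0 f (y : R) : continuous f -> continuous (fun x => f (x, y)).
Proof.
move=> cf; apply: (@continuous_slices R f id (cst y)) => //.
- by move=> x; exact: cvg_id.
- by move=> x; exact: cvg_cst.
Qed.

Lemma continuous_slice1 f (x : R) : continuous f -> continuous (fun y => f (x, y)).
Proof.
move=> cf; apply: (@continuous_slices R f (cst x) id) => //.
- by move=> y; exact: cvg_cst.
- by move=> y; exact: cvg_id.
Qed.

Lemma disc_integrable_setT f : continuous f ->
  (area R).-integrable setT ((EFin \o f) \_ disc).
Proof.
move=> cf; rewrite -integrable_mkcond; last exact: measurable_unit_ball.
exact: continuous_integrable_ball.
Qed.

(** By Fubini, integrate first along the chords parallel to the i-th axis, where the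
fundamental theorem of calculus leaves the values of f at the two ends. *)
Lemma disc_Green i f : smooth f ->
  \int[area R]_(x in disc) partial i f x =
  \int[leb]_(t in `[0, 2 * pi])
    (f (circle_point t) * component i (circle_point t)).
Proof.
move=> Hf; have cf := smooth_cont Hf; have cp := smooth_cont (smooth_partial i Hf).
rewrite {1}/Rintegral integral_mkcond.
have Hint := disc_integrable_setT cp.
have [i0|i1] : i = 0 \/ i = 1.
  by case: i {cp Hint} => [[|[|//]] ?]; [left|right]; exact: val_inj.
- rewrite i0 in cp Hint *; rewrite circle_integral_cos //.
  rewrite -(integral21_prod_meas1 Hint) /fubini_G.
  rewrite [in RHS]/Rintegral [in RHS]integral_mkcond; congr fine.
  apply: eq_integral => y _.
  have H := chord_integral y (continuous_slice0 (y:=y) cp)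
    (fun t => is_derive_slice0 y t Hf).
  apply: (eq_trans (eq_trans _ H)); last by rewrite restrict_EFin /= patchE.
  by apply: eq_integral.
- rewrite i1 in cp Hint *; rewrite circle_integral_sin //.
  rewrite -(integral12_prod_meas1 Hint) /fubini_F.
  rewrite [in RHS]/Rintegral [in RHS]integral_mkcond; congr fine.
  apply: eq_integral => x _.
  have H := chord_integral x (continuous_slice1 (x:=x) cp)
    (fun t => is_derive_slice1 x t Hf).
  apply: (eq_trans (eq_trans _ H)); last by rewrite restrict_EFin /= patchE.
  apply: eq_integral => y _; rewrite !patchE; congr (if _ then _ else _).
  by apply/idP/idP; rewrite !inE /unit_ball /= addrC.
Qed.

End Green.

(** * Limits in L^2 *)

Lemma ae_imp d (T : measurableType d) (R : realType)
    (mu : {measure set T -> \bar R}) (P Q : T -> Prop) :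
  (forall x, P x -> Q x) -> {ae mu, forall x, P x} -> {ae mu, forall x, Q x}.
Proof. by move=> PQ; apply: filterS. Qed.

Lemma ae_and d (T : measurableType d) (R : realType)
    (mu : {measure set T -> \bar R}) (P Q : T -> Prop) :
  {ae mu, forall x, P x} -> {ae mu, forall x, Q x} ->
  {ae mu, forall x, P x /\ Q x}.
Proof. by apply: filterS2. Qed.

Section L2.
Context d (T : measurableType d) (R : realType).
Variables (mu : {measure set T -> \bar R}) (D : set T).
Hypothesis mD : measurable D.
Implicit Types (f g h q : T -> R).

Lemma L2_integrable_sqr f : in_L2 mu D f ->
  mu.-integrable D (EFin \o (fun x => f x ^+ 2)).
Proof.
move=> [mf f2]; apply/integrableP; split.
  by apply/measurable_EFinP; apply: measurable_funX.
apply: le_lt_trans f2; rewrite le_eqVlt; apply/orP; left; apply/eqP.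
by apply: eq_integral => x _ /=; rewrite ger0_norm // sqr_ge0.
Qed.

Lemma L2_integrable_mul f g : in_L2 mu D f -> in_L2 mu D g ->
  mu.-integrable D (EFin \o (fun x => f x * g x)).
Proof.
move=> Hf Hg; have [mf _] := Hf; have [mg _] := Hg.
apply: (le_integrable mD (g := EFin \o (fun x => f x ^+ 2 + g x ^+ 2))).
- by apply/measurable_EFinP; exact: measurable_funM.
- move=> x _ /=; rewrite lee_fin [X in _ <= X]ger0_norm ?addr_ge0 ?sqr_ge0 //.
  rewrite normrM -[f x ^+ 2]real_normK ?num_real //.
  rewrite -[g x ^+ 2]real_normK ?num_real //.
  have := normr_ge0 (f x); have := normr_ge0 (g x); nra.
- have H := integrableD mD (L2_integrable_sqr Hf) (L2_integrable_sqr Hg).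
  by apply: eq_integrable H.
Qed.

Lemma L2_intro f : measurable_fun D f ->
  mu.-integrable D (EFin \o (fun x => f x ^+ 2)) -> in_L2 mu D f.
Proof.
move=> mf /integrableP[_ H]; split=> //; apply: le_lt_trans H.
rewrite /sqL2norm le_eqVlt; apply/orP; left; apply/eqP.
by apply: eq_integral => x _ /=; rewrite ger0_norm // sqr_ge0.
Qed.

Lemma L2B f g : in_L2 mu D f -> in_L2 mu D g -> in_L2 mu D (f \- g).
Proof.
move=> Hf Hg; have [mf _] := Hf; have [mg _] := Hg.
apply: L2_intro; first exact: measurable_funB.
have H := integrableD mD (integrableZl mD 2 (L2_integrable_sqr Hf))
  (integrableZl mD 2 (L2_integrable_sqr Hg)).
apply: (le_integrable mD _ _ H).
  by apply/measurable_EFinP/measurable_funX; exact: measurable_funB.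
move=> x _ /=; rewrite lee_fin [X in X <= _]ger0_norm ?sqr_ge0 //.
apply: le_trans (ler_norm _).
by rewrite -subr_ge0 [X in 0 <= X](_ : _ = (f x + g x) ^+ 2) ?sqr_ge0 //; ring.
Qed.

Lemma L2_sqE f : in_L2 mu D f ->
  sqL2norm mu D f = (\int[mu]_(x in D) (f x ^+ 2))%:E.
Proof.
move=> Hf; rewrite /sqL2norm /Rintegral fineK //.
exact: integrable_fin_num (L2_integrable_sqr Hf).
Qed.

(** A substitute for the Cauchy-Schwarz inequality: in a limit h -> 0, the weight t
is chosen according to the precision that is wanted. *)
Lemma L2_young h q (t : R) : 0 < t -> in_L2 mu D h -> in_L2 mu D q ->
  `|\int[mu]_(x in D) (h x * q x)| <=
  (2 * t)^-1 * \int[mu]_(x in D) (h x ^+ 2) + t / 2 * \int[mu]_(x in D) (q x ^+ 2).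
Proof.
move=> t0 Hh Hq.
have Ih := L2_integrable_sqr Hh; have Iq := L2_integrable_sqr Hq.
have Ihq := L2_integrable_mul Hh Hq.
apply: le_trans (le_normr_Rintegral mD Ihq) _.
have Zh : mu.-integrable D (EFin \o (fun x => (2 * t)^-1 * h x ^+ 2)).
  by have := integrableZl mD (2 * t)^-1 Ih; apply: eq_integrable.
have Zq : mu.-integrable D (EFin \o (fun x => t / 2 * q x ^+ 2)).
  by have := integrableZl mD (t / 2) Iq; apply: eq_integrable.
rewrite -!RintegralZl // -RintegralD //; apply: le_Rintegral => //.
- by have := integrable_norm Ihq; apply: eq_integrable.
- by have := integrableD mD Zh Zq; apply: eq_integrable.
- move=> x _; rewrite normrM -[h x ^+ 2]real_normK ?num_real //.
  rewrite -[q x ^+ 2]real_normK ?num_real //.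
  move: `|h x| `|q x| => a b.
  have := sqr_ge0 (a - t * b) => H.
  rewrite -subr_ge0 [X in 0 <= X](_ : _ = (2 * t)^-1 * (a - t * b) ^+ 2).
    by rewrite mulr_ge0 // invr_ge0 mulr_ge0 // ltW.
  by field; rewrite gt_eqF.
Qed.

Lemma cvg_L2_real (w : nat -> T -> R) f : (forall n, in_L2 mu D (w n)) ->
  in_L2 mu D f -> cvg_L2 mu D w f ->
  \int[mu]_(x in D) ((w n \- f) x ^+ 2) @[n --> \oo] --> (0 : R).
Proof.
move=> Hw Hf; rewrite /cvg_L2.
have -> : (fun n => sqL2norm mu D (w n \- f)) =
    (fun n => (\int[mu]_(x in D) ((w n \- f) x ^+ 2))%:E).
  by apply/funext => n; rewrite L2_sqE //; exact: L2B.
exact: fine_cvg.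
Qed.

Lemma cvg_L2_pairing (w : nat -> T -> R) f q : (forall n, in_L2 mu D (w n)) ->
  in_L2 mu D f -> in_L2 mu D q -> cvg_L2 mu D w f ->
  \int[mu]_(x in D) (w n x * q x) @[n --> \oo] --> \int[mu]_(x in D) (f x * q x).
Proof.
move=> Hw Hf Hq /(cvg_L2_real Hw Hf) H.
apply/cvgrPdist_lt => e e0.
set B := \int[mu]_(x in D) (q x ^+ 2).
have B0 : 0 <= B by apply: Rintegral_ge0 => x _; exact: sqr_ge0.
have B1 : 0 < B + 1 by rewrite ltr_wpDl.
have t0 : 0 < e / (B + 1) by rewrite divr_gt0.
(* With this weight, the term of L2_young in q contributes less than e / 2. *)
set t := e / (B + 1) in t0.
have tB : t / 2 * B < e / 2.
  have -> : e / 2 = t / 2 * (B + 1) by rewrite /t; field; rewrite gt_eqF.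
  by rewrite ltr_pM2l ?divr_gt0 // ltrDl.
clearbody t.
have d0 : 0 < t * e by rewrite mulr_gt0.
near=> n.
have Hn : \int[mu]_(x in D) ((w n \- f) x ^+ 2) < t * e.
  near: n; move/cvgrPdist_lt : H => /(_ _ d0); apply: filterS => n.
  by rewrite sub0r normrN => /(le_lt_trans (ler_norm _)).
rewrite distrC -RintegralB //; try exact: L2_integrable_mul.
rewrite (@eq_Rintegral _ _ _ _ _ (fun x => (w n \- f) x * q x)); last first.
  by move=> x _ /=; rewrite mulrBl.
apply: le_lt_trans (L2_young t0 (L2B (Hw n) Hf) Hq) _.
rewrite (splitr e); apply: ltrD => //.
rewrite ltr_pdivrMl ?mulr_gt0 // (_ : 2 * t * (e / 2) = t * e) //.
by field.
Unshelve. all: by end_near. Qed.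

Lemma L2_ae_zero f : in_L2 mu D f -> \int[mu]_(x in D) (f x ^+ 2) = 0 ->
  {ae mu, forall x, D x -> f x = 0}.
Proof.
move=> Hf f0; have If := L2_integrable_sqr Hf.
pose F := EFin \o (fun x => f x ^+ 2).
have : (\int[mu]_(x in D) `|F x| = 0)%E.
  have <- : sqL2norm mu D f = 0%E by rewrite L2_sqE // f0.
  by apply: eq_integral => x _; rewrite /= ger0_norm ?sqr_ge0.
move/(ae_eq_integral_abs mu mD (measurable_int _ If)).
apply: filterS => x H /H /=.
by move=> [] /eqP; rewrite sqrf_eq0 => /eqP.
Qed.

End L2.

(** * The fundamental lemma of the calculus of variations *)

Section NullInduction.
Context d d' (T : measurableType d) (T' : measurableType d') (R : realType).
Variables (mu : {measure set T -> \bar R}) (H : T -> \bar R) (p : T -> T').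
Hypotheses (iH : mu.-integrable setT H) (mp : measurable_fun setT p).

(** Dynkin's pi-lambda theorem for the signed measure that maps A to the integral of
H over the part of C that p sends to A.  With p a coordinate it extends a vanishing
property from quadrants to rectangles, one side at a time; with p the identity
it extends it from rectangles to all measurable sets. *)
Lemma null_integral_induction (C : set T) (G : set (set T')) :
  measurable C -> @measurable _ T' = <<s G>> -> setI_closed G ->
  (\int[mu]_(x in C) H x = 0)%E ->
  (forall A, G A -> (\int[mu]_(x in C `&` p @^-1` A) H x = 0)%E) ->
  forall A, measurable A -> (\int[mu]_(x in C `&` p @^-1` A) H x = 0)%E.
Proof.
move=> mC GE GI C0 HG A; rewrite GE.
have mpre B : measurable B -> measurable (C `&` p @^-1` B).
  by move=> mB; apply: measurableI => //; rewrite -[_ @^-1` _]setTI; exact: mp.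
have iHS B : measurable B -> mu.-integrable B H.
  by move=> mB; apply: integrableS iH.
apply: (@dynkin_induction _ T' G
  (fun A => (\int[mu]_(x in C `&` p @^-1` A) H x = 0)%E)) => //.
- by rewrite preimage_setT setIT.
- move=> S mS S0; move: C0.
  have mS' := mpre _ mS; have mCS := mpre _ (measurableC mS).
  have {1}-> : C = (C `&` p @^-1` S) `|` (C `&` p @^-1` (~` S)).
    by rewrite -setIUr -preimage_setU setUCr preimage_setT setIT.
  rewrite integral_setU //=.
  + by rewrite S0 add0e.
  + by apply: (measurable_int mu); apply: iHS; exact: measurableU.
  + apply/disj_set2P; rewrite setIACA -preimage_setI setICr.
    by rewrite preimage_set0 setI0.
- move=> F mF tF F0; rewrite preimage_bigcup setI_bigcupr.
  have mCF : measurable (\bigcup_i (C `&` p @^-1` F i)).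
    by apply: bigcupT_measurable => k; exact: mpre.
  rewrite integral_bigcup //.
  + by apply: eseries0 => k _ _; exact: F0.
  + move=> i j _ _ [x [[_ Fi] [_ Fj]]]; apply: tF => //.
    by exists (p x).
  + by move=> k; exact: mpre.
  + exact: iHS.
Qed.

End NullInduction.

Section FundamentalLemma.
Variable R : realType.
Local Notation leb := (@lebesgue_measure R).
Local Notation disc := (@unit_ball R).
Local Notation mR := (measurableTypeR R).
Local Notation plane := (measurableTypeR R * measurableTypeR R)%type.

(** A test function close to the indicator of the quadrant x > a, y > b within the
disc.  The last factor vanishes where x^2 + y^2 > 1 - 1 / k. *)
Definition cutoff (k : nat) (a b : R) (x : R * R) : R :=
  flat 0 (k%:R * (x.1 - a) - 0) * flat 0 (k%:R * (x.2 - b) - 0) *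
  flat 0 (k%:R * (1 - (x.1 ^+ 2 + x.2 ^+ 2)) - 1).

Lemma smooth_cutoff k a b : smooth (cutoff k a b).
Proof.
have S0 := @smooth_component R 0; have S1 := @smooth_component R 1.
have aff (q : R * R -> R) c c' : smooth q ->
    smooth (fun x => flat 0 (k%:R * (q x - c) - c')).
  move=> Hq; apply: (@smooth_flat R (fun x => k%:R * (q x - c) - c')).
  apply: smoothB; last exact: smooth_cst.
  apply: smoothM; first exact: smooth_cst.
  by apply: smoothB => //; exact: smooth_cst.
apply: smoothM.
  by apply: smoothM; [exact: (aff _ a 0 S0)|exact: (aff _ b 0 S1)].
apply: (@smooth_flat R (fun x => k%:R * (1 - (x.1 ^+ 2 + x.2 ^+ 2)) - 1)).
apply: smoothB; last exact: smooth_cst.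
apply: smoothM; first exact: smooth_cst.
apply: smoothB; first exact: smooth_cst.
by apply: smoothD; under eq_fun do rewrite expr2; apply: smoothM.
Qed.

Lemma test_cutoff k a b : test_function (cutoff k a b).
Proof.
pose S := [set x : R * R | x.1 ^+ 2 + x.2 ^+ 2 <= 1 - k%:R^-1 /\ (0 < k)%N].
have sub : [set x | cutoff k a b x != 0] `<=` S.
  move=> x /=; rewrite /cutoff mulf_eq0 negb_or => /andP[_].
  rewrite /flat; case: ltP; rewrite ?eqxx // subr_gt0 => H _.
  have k0 : (0 < k)%N.
    by rewrite lt0n; apply/eqP => k0; move: H; rewrite k0 mul0r ltr10.
  split=> //; have k0' : 0 < k%:R :> R by rewrite ltr0n.
  rewrite lerBrDr addrC -lerBrDr -(ler_pM2l k0') divff ?gt_eqF //; exact: ltW.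
have Sball : S `<=` disc.
  move=> x [Sx k0]; rewrite /unit_ball /=; apply: le_lt_trans Sx _.
  by rewrite ltrBlDr ltrDl invr_gt0 ltr0n.
have cS : closed S.
  have c2 : continuous (fun x : R * R => x.1 ^+ 2 + x.2 ^+ 2).
    apply: continuous_add; under eq_fun do rewrite expr2; apply: continuous_mul => x;
      by [exact: cvg_fst|exact: cvg_snd].
  case: (ltnP 0 k) => k0.
    rewrite (_ : S =
        (fun x : R * R => x.1 ^+ 2 + x.2 ^+ 2) @^-1` `]-oo, (1 - k%:R^-1)]).
      by apply: closed_comp; [move=> x _; exact: c2|exact: interval_closed].
    apply/seteqP; split => x /=; rewrite in_itv /=; first by case.
    by move=> ?; split.
  rewrite (_ : S = set0); first exact: closed0.
  by apply/seteqP; split => // x [_]; rewrite ltnNge k0.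
have clS : closure [set x | cutoff k a b x != 0] `<=` S.
  by rewrite [X in _ `<=` X](closure_id S).1 //; exact: closure_subset.
split; first exact: smooth_cutoff; last exact: subset_trans Sball.
apply: (@subclosed_compact _ _ (`[(-1 : R), 1]%classic `*` `[(-1 : R), 1]%classic)).
- exact: closed_closure.
- by apply: compact_setX; exact: segment_compact.
- move=> x /clS /Sball /unit_ball_box [x1 x2].
  by split => /=; rewrite in_itv /= -ler_norml.
Qed.

Lemma cutoff_norm_le1 k a b x : `|cutoff k a b x| <= 1.
Proof.
rewrite ger0_norm; last by rewrite !mulr_ge0 ?flat_ge0.
by rewrite !mulr_ile1 ?mulr_ge0 ?flat_ge0 ?flat0_le1.
Qed.

Lemma cutoff_cvg a b x : disc x ->
  cutoff k a b x @[k --> \oo] --> ((a < x.1)%R%:R * (b < x.2)%R%:R : R).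
Proof.
move=> Dx.
have -> : ((a < x.1)%R%:R * (b < x.2)%R%:R : R) =
  (0 < x.1 - a)%R%:R * (0 < x.2 - b)%R%:R * (0 < 1 - (x.1 ^+ 2 + x.2 ^+ 2))%R%:R.
  by rewrite !subr_gt0 (Dx : _ < 1) mulr1.
apply: cvgM; first by apply: cvgM; exact: flat0_cvg.
exact: flat0_cvg.
Qed.

(** The cutoff functions and dominated convergence show that h has integral 0 over
the part of the disc in any quadrant, hence over any measurable part of it. *)
Lemma fundamental_lemma (h : R * R -> R) :
  (area R).-integrable disc (EFin \o h) ->
  (forall phi, test_function phi ->
    \int[area R]_(x in disc) (h x * phi x) = 0) ->
  {ae area R, forall x, disc x -> h x = 0}.
Proof.
move=> ih H0.
have mD := @measurable_unit_ball R.
have mh : measurable_fun disc (h : plane -> R).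
  by apply/measurable_EFinP; exact: (measurable_int (area R) ih).
have rays (a b : R) : (\int[area R]_(x in disc `&`
    (`]a, +oo[%classic `*` `]b, +oo[%classic)) (h x)%:E = 0)%E.
  pose phi k (x : plane) := cutoff k a b x.
  have mphi k : measurable_fun disc (phi k).
    apply: (measurable_funS measurableT) => //.
    by apply: continuous_measurable_plane; apply: smooth_cont; exact: smooth_cutoff.
  have mA : measurable (`]a, +oo[%classic `*` `]b, +oo[%classic : set plane).
    by apply: measurableX; exact: measurable_itv.
  have [| | | | |_ _] := @dominated_convergence _ plane R (area R) disc mD
     (fun k x => (h x * phi k x)%:E)
     ((EFin \o h) \_ (`]a, +oo[%classic `*` `]b, +oo[%classic))
     (fun x => `|h x|%:E).
  - move=> k; apply/measurable_EFinP. exact: (measurable_funM mh (mphi k)).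
  - apply/measurable_restrict => //; apply: (measurable_funS mD) => //.
    exact/measurable_EFinP.
  - apply: aeW => x Dx; rewrite patchE.
    have -> : (if x \in `]a, +oo[%classic `*` `]b, +oo[%classic
        then (EFin \o h) x else 0%E) =
        (h x * ((a < x.1)%R%:R * (b < x.2)%R%:R))%:E.
      rewrite in_setX /= !mem_setE !in_itv /= !andbT.
      by case: (a < x.1); case: (b < x.2); rewrite /= ?mulr1 ?mulr0.
    apply: cvg_EFin; first exact: nearW.
    by apply: cvgMr; exact: cutoff_cvg.
  - by have := integrable_norm ih; apply: eq_integrable.
  - apply: aeW => x k Dx /=; rewrite lee_fin normrM ler_piMr //.
    exact: cutoff_norm_le1.
  rewrite integral_mkcondr => H1.
  have H2 : (fun k => (\int[area R]_(x in disc) (h x * phi k x)%:E)%E) = (fun=> 0%E).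
    apply/funext => k; have := H0 _ (test_cutoff k a b); rewrite /Rintegral => E.
    have I : (area R).-integrable disc (EFin \o (fun x => h x * phi k x)).
      apply: (le_integrable mD _ _ ih).
        by apply/measurable_EFinP; exact: (measurable_funM mh (mphi k)).
      by move=> x _ /=; rewrite lee_fin normrM ler_piMr // cutoff_norm_le1.
    by rewrite -(fineK (integrable_fin_num mD I)) E.
  rewrite H2 in H1.
  by rewrite -(cvg_lim (@ereal_hausdorff R) H1) lim_cst.
pose H : plane -> \bar R := (EFin \o h) \_ disc.
have iH : (area R).-integrable setT H by rewrite -integrable_mkcond.
have HE (A : set plane) : (\int[area R]_(x in A) H x)%E =
    (\int[area R]_(x in disc `&` A) (h x)%:E)%E.
  by rewrite integral_mkcondl.
have pi_rays : setI_closed (@RGenOInfty.G R).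
  move=> _ _ [x ->] [y ->]; exists (Num.max x y).
  by apply/seteqP; split => z /=; rewrite !in_itv /= !andbT gt_max => /andP.
have genR : @measurable _ mR = <<s @RGenOInfty.G R >> := RGenOInfty.measurableE R.
(* Only the part of a set within the disc matters.  In particular the whole line
   can be traded for the ray ]-2, +oo[ in either coordinate. *)
have full (A : set plane) (B : set plane) : (forall x, disc x -> A x <-> B x) ->
    (\int[area R]_(x in A) H x = \int[area R]_(x in B) H x)%E.
  move=> AB; rewrite !HE; congr (integral _ _ _); apply/seteqP.
  by split=> x [Dx]; split=> //; apply/AB.
have m2 x : disc x -> -2 < x.1 /\ -2 < x.2.
  move=> /unit_ball_box; rewrite !ler_norml => -[/andP[? _] /andP[? _]].
  by split; lra.
have mray (a : R) : measurable (`]a, +oo[%classic : set mR) by exact: measurable_itv.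
have strip (b : R) (A : set mR) : measurable A ->
    (\int[area R]_(x in (snd @^-1` `]b, +oo[%classic) `&` fst @^-1` A) H x = 0)%E.
  move=> mA; apply: (null_integral_induction iH _ _ genR) => //.
  - by rewrite -[_ @^-1` _]setTI; exact: measurable_snd.
  - rewrite -[RHS](rays (-2) b) -HE; apply: full => x /m2[x1 x2] /=.
    by rewrite !in_itv /= x1 !andbT; split => [|[]].
  - move=> _ [a ->]; rewrite -[RHS](rays a b) -HE; apply: full => x Dx /=.
    by split => -[].
have rect (A B : set mR) : measurable A -> measurable B ->
    (\int[area R]_(x in (fst @^-1` A) `&` snd @^-1` B) H x = 0)%E.
  move=> mA mB; apply: (null_integral_induction iH _ _ genR) => //.
  - by rewrite -[_ @^-1` _]setTI; exact: measurable_fst.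
  - rewrite -[RHS](strip (-2) A mA); apply: full => x /m2[x1 x2] /=.
    by rewrite !in_itv /= x2 !andbT; split => [|[]].
  - by move=> _ [b ->]; rewrite setIC; exact: strip.
have all0 (A : set plane) : measurable A -> (\int[area R]_(x in A) H x = 0)%E.
  move=> mA; rewrite -[A]setTI.
  apply: (null_integral_induction (p := id) iH _ _
    (measurable_prod_measurableType mR mR)) => //.
  - move=> _ _ [A1 mA1 [B1 mB1 <-]] [A2 mA2 [B2 mB2 <-]].
    exists (A1 `&` A2); first exact: measurableI.
    exists (B1 `&` B2); first exact: measurableI.
    by rewrite setXI.
  - have := rect setT setT measurableT measurableT.
    by rewrite !preimage_setT setIT.
  - move=> _ [A1 mA1 [B1 mB1 <-]]; rewrite setTI; exact: rect.
have : ae_eq (area R) setT H (cst 0%E).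
  apply: integral_ae_eq => //.
  by move=> E _ mE; rewrite all0 // integral0.
apply: filterS => x /= /(_ I) + Dx.
by rewrite /H patchE mem_set // => -[].
Qed.

End FundamentalLemma.

(** * Weak derivatives, traces and null Lagrangians *)

Section Sobolev.
Variable R : realType.
Local Notation leb := (@lebesgue_measure R).
Local Notation disc := (@unit_ball R).
Local Notation plane := (measurableTypeR R * measurableTypeR R)%type.
Local Notation angles := (`[0%R, (2 * pi)%R]%classic : set R).
Implicit Types (f g v w b : R * R -> R) (i j : 'I_2).
Implicit Types (p q : 'I_2 -> R * R -> R).

Let mD : measurable (disc : set plane) := @measurable_unit_ball R.
Let mC : measurable (angles : set (measurableTypeR R)).
Proof. exact: measurable_itv. Qed.

Lemma smooth_L2 f : smooth f -> in_L2 (area R) disc f.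
Proof. by move=> Hf; apply: continuous_L2_ball; exact: smooth_cont. Qed.

Lemma continuous_L2_angles (f : R -> R) : continuous f -> in_L2 leb angles f.
Proof.
move=> cf; apply: L2_intro => //.
  by apply: (measurable_funS measurableT) => //; exact: continuous_measurable_fun.
apply: continuous_integrable_itv => t.
by under eq_fun do rewrite expr2; exact: (cvgM (cf t) (cf t)).
Qed.

Lemma smooth_L2_angles f : smooth f -> in_L2 leb angles (f \o @circle_point R).
Proof.
move=> Hf; apply: continuous_L2_angles; apply: continuous_circle.
exact: smooth_cont.
Qed.

Lemma weak_partialP i f : W12 f -> is_weak_partial i f (weak_partial i f).
Proof. by move=> [_ /(_ i) H]; exact: (getPex H). Qed.

Lemma weak_partial_L2 i f : W12 f -> in_L2 (area R) disc (weak_partial i f).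
Proof. by move=> /(weak_partialP i)[]. Qed.

Lemma test_function_circle phi (t : R) : test_function phi ->
  phi (circle_point t) = 0.
Proof.
move=> [_ _ sub]; apply/eqP/negPn/negP => H.
have : disc (circle_point t) by apply: sub; exact: subset_closure.
by rewrite /unit_ball /= cos2Dsin2 ltxx.
Qed.

(** Green's formula for f phi, whose boundary term vanishes with phi. *)
Lemma smooth_is_weak_partial i f : smooth f -> is_weak_partial i f (partial i f).
Proof.
move=> Hf; split; first exact/smooth_L2/smooth_partial.
move=> phi Hphi; have [sphi _ _] := Hphi.
have spf := smooth_partial i Hf; have spp := smooth_partial i sphi.
apply/eqP; rewrite -addr_eq0 -RintegralD //; last 2 first.
- by apply: L2_integrable_mul => //; exact: smooth_L2.
- by apply: L2_integrable_mul => //; exact: smooth_L2.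
rewrite (_ : Rintegral _ _ _ =
  \int[area R]_(x in disc) partial i (fun y => f y * phi y) x).
  rewrite disc_Green; last exact: smoothM.
  rewrite (@eq_Rintegral _ _ _ leb angles (fun=> 0)); last first.
    by move=> t _; rewrite (test_function_circle t Hphi) mulr0 mul0r.
  by rewrite Rintegral_cst // mul0r.
by apply: eq_Rintegral => x _; rewrite partialM // addrC.
Qed.

Lemma weak_partial_unique i f (g1 g2 : R * R -> R) :
  is_weak_partial i f g1 -> is_weak_partial i f g2 ->
  {ae area R, forall x, disc x -> g1 x = g2 x}.
Proof.
move=> [L1 H1] [L2 H2].
have L := L2B mD L1 L2.
have c1 : in_L2 (area R) disc (fun=> 1 : R) by apply: smooth_L2; exact: smooth_cst.
have int : (area R).-integrable disc (EFin \o (g1 \- g2)).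
  have := L2_integrable_mul mD L c1; apply: eq_integrable => // x _ /=.
  by rewrite mulr1.
have : {ae area R, forall x, disc x -> (g1 \- g2) x = 0}.
  apply: fundamental_lemma => // phi Hphi.
  have Lp : in_L2 (area R) disc phi by apply: smooth_L2; case: Hphi.
  have E : \int[area R]_(x in disc) (g1 x * phi x) =
      \int[area R]_(x in disc) (g2 x * phi x).
    by apply: oppr_inj; rewrite -H1 // -H2.
  rewrite (@eq_Rintegral _ _ _ (area R) disc (fun x => g1 x * phi x - g2 x * phi x)).
    by rewrite RintegralB ?E ?subrr //; exact: L2_integrable_mul.
  by move=> x _ /=; rewrite mulrBl.
by apply: ae_imp => x H /H /= /eqP; rewrite subr_eq0 => /eqP.
Qed.

Lemma smooth_W12 f : smooth f -> W12 f.
Proof.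
move=> Hf; split; first exact: smooth_L2.
by move=> i; exists (partial i f); exact: smooth_is_weak_partial.
Qed.

Lemma weak_partial_smooth i f : smooth f ->
  {ae area R, forall x, disc x -> weak_partial i f x = partial i f x}.
Proof.
move=> Hf; apply: (@weak_partial_unique i f).
  exact/weak_partialP/smooth_W12.
exact: smooth_is_weak_partial.
Qed.

Lemma sqL2norm_ae d (T : measurableType d) (mu : {measure set T -> \bar R})
    (D : set T) (h : T -> R) : measurable D -> measurable_fun D h ->
  {ae mu, forall x, D x -> h x = 0} -> sqL2norm mu D h = 0%E.
Proof.
move=> mD' mh h0; rewrite /sqL2norm -[RHS](integral0 mu D).
apply: ge0_ae_eq_integral => //.
- by apply/measurable_EFinP; exact: measurable_funX.
- by move=> x _; rewrite lee_fin sqr_ge0.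
- by apply: ae_imp h0 => x H Dx; rewrite H // expr2 mulr0.
Qed.

Lemma smooth_has_trace f : smooth f -> has_trace f f.
Proof.
move=> Hf; split; first exact: smooth_L2_angles.
have self d (T : measurableType d) (mu : {measure set T -> \bar R}) (D : set T) h :
    cvg_L2 mu D (fun _ : nat => h) h.
  rewrite /cvg_L2 (_ : (fun _ => _) = fun=> 0%E); first exact: cvg_cst.
  apply/funext => n; rewrite /sqL2norm integral0_eq // => x _ /=.
  by rewrite subrr expr2 mulr0.
exists (fun=> f); split=> //.
move=> i; rewrite /cvg_L2 (_ : (fun _ => _) = fun=> 0%E); first exact: cvg_cst.
have [mp _] := smooth_L2 (smooth_partial i Hf).
have [mw _] := weak_partial_L2 i (smooth_W12 Hf).
apply/funext => n; apply: sqL2norm_ae => //; first exact: measurable_funB.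
by apply: ae_imp (weak_partial_smooth i Hf) => x H Dx /=; rewrite H // subrr.
Qed.

(** For gradients of two functions this is the integral of the Jacobian determinant
of the map that they form. *)
Definition jac p q : R := \int[area R]_(x in disc) (p 0 x * q 1 x - p 1 x * q 0 x).

Definition grad f : 'I_2 -> R * R -> R := fun i => partial i f.
Definition wgrad f : 'I_2 -> R * R -> R := fun i => weak_partial i f.

Lemma jacE p q : (forall i, in_L2 (area R) disc (p i)) ->
  (forall i, in_L2 (area R) disc (q i)) ->
  jac p q = \int[area R]_(x in disc) (p 0 x * q 1 x) -
            \int[area R]_(x in disc) (p 1 x * q 0 x).
Proof. by move=> Hp Hq; rewrite -RintegralB //; exact: L2_integrable_mul. Qed.

Lemma jac_antisym p q : (forall i, in_L2 (area R) disc (p i)) ->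
  (forall i, in_L2 (area R) disc (q i)) -> jac p q = - jac q p.
Proof.
move=> Hp Hq; rewrite !jacE // opprB; congr (_ - _);
  by apply: eq_Rintegral => x _; rewrite mulrC.
Qed.

Lemma jac_cvg (P : nat -> 'I_2 -> R * R -> R) p q :
  (forall n i, in_L2 (area R) disc (P n i)) ->
  (forall i, in_L2 (area R) disc (p i)) -> (forall i, in_L2 (area R) disc (q i)) ->
  (forall i, cvg_L2 (area R) disc (fun n => P n i) (p i)) ->
  jac (P n) q @[n --> \oo] --> jac p q.
Proof.
move=> HP Hp Hq cv; rewrite jacE //; under eq_fun do rewrite jacE //.
by apply: (@cvgB _ R^o); apply: cvg_L2_pairing.
Qed.

Lemma grad_L2 f i : smooth f -> in_L2 (area R) disc (grad f i).
Proof. by move=> Hf; exact/smooth_L2/smooth_partial. Qed.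

(** The derivative of b along the circle, expressed without differentiating
b \o circle_point. *)
Definition tangential b (t : R) : R :=
  partial 1 b (circle_point t) * cos t - partial 0 b (circle_point t) * sin t.

Lemma continuous_tangential b : smooth b -> continuous (tangential b).
Proof.
move=> Hb t; apply: (@cvgB _ R^o); apply: cvgM.
- by apply: continuous_circle; apply: smooth_cont; exact: smooth_partial.
- exact: continuous_cos.
- by apply: continuous_circle; apply: smooth_cont; exact: smooth_partial.
- exact: continuous_sin.
Qed.

(** The Jacobian is the divergence of (w b_y, - w b_x), because the mixed derivatives
of b cancel.  On the circle no derivative of w is left, so both sides are
continuous in w for the convergence that defines traces. *)
Lemma jac_boundary w b : smooth w -> smooth b ->
  jac (grad w) (grad b) =
  \int[leb]_(t in angles) (w (circle_point t) * tangential b t).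
Proof.
move=> Hw Hb; have Hp i := smooth_partial i Hb.
have S0 : smooth (fun x => w x * partial 1 b x) by exact: smoothM.
have S1 : smooth (fun x => w x * partial 0 b x) by exact: smoothM.
have cw := continuous_circle (smooth_cont Hw).
have cb i := continuous_circle (smooth_cont (Hp i)).
have cp f i : smooth f -> (area R).-integrable disc (EFin \o partial i f).
  move=> Hf; apply: continuous_integrable_ball; apply: smooth_cont.
  exact: smooth_partial.
have E : jac (grad w) (grad b) =
    \int[area R]_(x in disc) partial 0 (fun x => w x * partial 1 b x) x -
    \int[area R]_(x in disc) partial 1 (fun x => w x * partial 0 b x) x.
  rewrite -(RintegralB mD (cp _ 0 S0) (cp _ 1 S1)) /jac.
  apply: eq_Rintegral => x _.
  rewrite (partialM 0 x Hw (Hp 1)) (partialM 1 x Hw (Hp 0)) (Schwarz Hb) /grad.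
  move: (w x) (partial 0 w x) (partial 1 w x) (partial 0 b x) (partial 1 b x).
  by move: (partial 0 _ x) => *; ring.
apply: (eq_trans E).
apply: (eq_trans (congr2 (fun a c => a - c) (disc_Green 0 S0) (disc_Green 1 S1))).
have I0 : leb.-integrable angles (EFin \o (fun t =>
    w (circle_point t) * partial 1 b (circle_point t) *
    component 0 (circle_point t))).
  apply: continuous_integrable_itv => t; apply: cvgM; last exact: continuous_cos.
  by apply: cvgM; [exact: cw|exact: cb].
have I1 : leb.-integrable angles (EFin \o (fun t =>
    w (circle_point t) * partial 0 b (circle_point t) *
    component 1 (circle_point t))).
  apply: continuous_integrable_itv => t; apply: cvgM; last exact: continuous_sin.
  by apply: cvgM; [exact: cw|exact: cb].
apply: (eq_trans (esym (RintegralB mC I0 I1))).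
by apply: eq_Rintegral => t _; rewrite /tangential /component /= mulrBr !mulrA.
Qed.

(** Both members of jac_boundary pass to the limit along the smooth functions that
define the trace of f. *)
Lemma jac_trace f g b : W12 f -> has_trace f g -> smooth g -> smooth b ->
  jac (wgrad f) (grad b) = jac (grad g) (grad b).
Proof.
move=> Wf [Lg [w [Hw _ cw tw]]] Hg Hb.
have A : jac (grad (w n)) (grad b) @[n --> \oo] --> jac (wgrad f) (grad b).
  apply: jac_cvg => //.
  - by move=> n i; exact: grad_L2.
  - by move=> i; exact: weak_partial_L2.
  - by move=> i; exact: grad_L2.
have B : jac (grad (w n)) (grad b) @[n --> \oo] --> jac (grad g) (grad b).
  rewrite jac_boundary //; under eq_fun do rewrite jac_boundary //.
  apply: (cvg_L2_pairing mC (w := fun n => w n \o @circle_point R)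
    (f := g \o @circle_point R)) => //.
  - by move=> n; exact: smooth_L2_angles.
  - by apply: continuous_L2_angles; exact: continuous_tangential.
exact: (cvg_unique _ A B).
Qed.

(** Let smooth functions converge to f2, paired with the fixed gradient of f1, which
jac_trace and antisymmetry allow to replace by that of g1. *)
Lemma jac_trace2 f1 f2 g1 g2 : W12 f1 -> has_trace f1 g1 -> smooth g1 ->
  W12 f2 -> has_trace f2 g2 -> smooth g2 ->
  jac (wgrad f1) (wgrad f2) = jac (grad g1) (grad g2).
Proof.
move=> W1 T1 S1 W2 T2 S2; have [_ [w [Hw _ cw _]]] := T2.
have L1 i : in_L2 (area R) disc (wgrad f1 i) by exact: weak_partial_L2.
have L2 i : in_L2 (area R) disc (wgrad f2 i) by exact: weak_partial_L2.
have Lg f i : smooth f -> in_L2 (area R) disc (grad f i) by exact: grad_L2.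
have A : jac (grad (w n)) (wgrad f1) @[n --> \oo] --> jac (wgrad f2) (wgrad f1).
  by apply: jac_cvg => // n i; exact: grad_L2.
have B : jac (grad (w n)) (wgrad f1) @[n --> \oo] --> jac (wgrad f2) (grad g1).
  rewrite (_ : (fun n => _) = (fun n => jac (grad (w n)) (grad g1))).
    by apply: jac_cvg => // [n i|i]; exact: grad_L2.
  apply/funext => n; rewrite jac_antisym //; last by move=> i; exact: grad_L2.
  rewrite (jac_trace W1 T1 S1 (Hw n)) [RHS]jac_antisym // => i; exact: grad_L2.
rewrite jac_antisym // (cvg_unique (@Rhausdorff R) A B) (jac_trace W2 T2 S2 S1).
by rewrite [RHS]jac_antisym // => i; exact: grad_L2.
Qed.

(** Green's formula for the field v^2 (x, y), whose divergence is
2 v^2 + 2 v (x v_x + y v_y), and whose normal component on the circle is v^2. *)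
Lemma trace_Poincare v : smooth v ->
  \int[area R]_(x in disc) (v x ^+ 2) <=
  \int[leb]_(t in angles) (v (circle_point t) ^+ 2) +
  (\int[area R]_(x in disc) (grad v 0 x ^+ 2) +
   \int[area R]_(x in disc) (grad v 1 x ^+ 2)).
Proof.
move=> Hv.
pose F i x := v x * v x * component i x.
have HF i : smooth (F i) by apply: smoothM; [exact: smoothM|exact: smooth_component].
have Hp i := smooth_partial i Hv.
have cont := fun f (Hf : smooth f) => continuous_integrable_ball (smooth_cont Hf).
have intF i : (area R).-integrable disc (EFin \o partial i (F i)).
  by apply: cont; exact: smooth_partial.
have int2 f : smooth f -> (area R).-integrable disc (EFin \o (fun x => f x ^+ 2)).
  by move=> Hf; apply: L2_integrable_sqr; exact: smooth_L2.
have bd : \int[leb]_(t in angles) (v (circle_point t) ^+ 2) =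
    \int[area R]_(x in disc) (partial 0 (F 0) x + partial 1 (F 1) x).
  have cF i : continuous (fun t => F i (circle_point t)).
    exact: (continuous_circle (smooth_cont (HF i))).
  have I0 : leb.-integrable angles (EFin \o (fun t =>
      F 0 (circle_point t) * component 0 (circle_point t))).
    apply: continuous_integrable_itv => t; apply: cvgM; last exact: continuous_cos.
    exact: cF.
  have I1 : leb.-integrable angles (EFin \o (fun t =>
      F 1 (circle_point t) * component 1 (circle_point t))).
    apply: continuous_integrable_itv => t; apply: cvgM; last exact: continuous_sin.
    exact: cF.
  apply: esym; apply: (eq_trans (RintegralD mD (intF 0) (intF 1))).
  apply: (eq_trans (congr2 (fun a c => a + c)
    (disc_Green 0 (HF 0)) (disc_Green 1 (HF 1)))).
  apply: (eq_trans (esym (RintegralD mC I0 I1))).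
  apply: eq_Rintegral => t _; rewrite /F /component /=.
  by rewrite -[RHS]mulr1 -(cos2Dsin2 t); ring.
rewrite -lerBlDr bd -(RintegralD mD (int2 _ (Hp 0)) (int2 _ (Hp 1))).
have intG : (area R).-integrable disc
    (EFin \o (fun x => grad v 0 x ^+ 2 + grad v 1 x ^+ 2)).
  have := integrableD mD (int2 _ (Hp 0)) (int2 _ (Hp 1)).
  by apply: eq_integrable.
rewrite -(RintegralB mD (int2 _ Hv) intG).
apply: le_Rintegral => //.
- have := integrableB mD (int2 _ Hv) intG; exact: eq_integrable.
- have := integrableD mD (intF 0) (intF 1); exact: eq_integrable.
move=> x Dx; have D1 : x.1 ^+ 2 + x.2 ^+ 2 < 1 := Dx.
have PF i : partial i (F i) x =
    (partial i v x * v x + v x * partial i v x) * component i x + v x * v x.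
  rewrite (partialM i x (smoothM Hv Hv) (@smooth_component R i)).
  rewrite (partialM i x Hv Hv).
  by rewrite partial_component eqxx mulr1.
rewrite !PF /grad /component /=.
move: (v x) (partial 0 v x) (partial 1 v x) x.1 x.2 D1 => a p q r s D1.
(* (r p + s q)^2 + (r q - s p)^2 = (r^2 + s^2) (p^2 + q^2) *)
rewrite -subr_ge0 [X in 0 <= X](_ : _ =
  (a + (r * p + s * q)) ^+ 2 + (r * q - s * p) ^+ 2 +
  (1 - (r ^+ 2 + s ^+ 2)) * (p ^+ 2 + q ^+ 2)); last by ring.
apply: addr_ge0; first by rewrite addr_ge0 ?sqr_ge0.
by apply: mulr_ge0; [rewrite subr_ge0 ltW|rewrite addr_ge0 ?sqr_ge0].
Qed.

End Sobolev.

(** * The minimization problem *)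

Section StoredEnergy.
Variable R : realType.

Lemma convex_ineq (F : R -> R) (h x y : R) : @convex_function R R^o setT F ->
  0 <= h -> h <= 1 -> F (h * x + (1 - h) * y) <= h * F x + (1 - h) * F y.
Proof.
by move=> cF h0 h1; have := cF (Itv01 h0 h1) x y (in_setT _) (in_setT _).
Qed.

(** By convexity the slope of F from a towards s is at most the slope of the chord;
let the step h tend to 0. *)
Lemma convex_tangent (F : R -> R) (a dF s : R) : @convex_function R R^o setT F ->
  is_derive a 1 F dF -> F a + dF * (s - a) <= F s.
Proof.
move=> cF HF; pose G (h : R) := F (h * (s - a) + a).
have : is_derive (0 : R) 1 G (dF * (s - a)).
  apply: (@is_derive1_comp _ F (fun h : R => h * (s - a) + a)).
    by rewrite mul0r add0r.
  by apply: is_derive_eq; rewrite ?addr0 /= /GRing.scale /= ?mulr0 ?add0r ?mulr1.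
move=> [dG eG].
have : h^-1 *: (G (h *: 1 + 0) - G 0) @[h --> (0 : R)^'+] --> dF * (s - a).
  rewrite -eG; apply: cvg_dnbhs_at_right; exact: dG.
move=> cG; rewrite addrC -lerBrDr.
apply: (cvgr_to_le cG); near=> h.
have h0 : 0 < h by [].
have h1 : h <= 1 by near: h; exact: nbhs_right_le.
rewrite /G addr0 [h *: 1]mulr1 mul0r add0r /GRing.scale /= ler_pdivrMl //.
have := convex_ineq s a cF (ltW h0) h1.
rewrite (_ : h * s + (1 - h) * a = h * (s - a) + a); last by ring.
move=> H; rewrite lerBlDr; apply: le_trans H _; rewrite le_eqVlt.
by apply/orP; left; apply/eqP; ring.
Unshelve. all: by end_near. Qed.

(** For s > 0, the point 0 is between -1 and s, and rho vanishes at -1 and at 0. *)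
Lemma stored_ge0 gamma s0 kappa (rho1 rho : R -> R) (s : R) :
  stored_energy gamma s0 kappa rho1 rho -> 0 <= rho s.
Proof.
move=> H; have [s1|s1] := leP s 0; first by rewrite (stored_rho_neg H).
have t0 : 0 < (s + 1)^-1 by rewrite invr_gt0 ltr_wpDl // ltW.
have t1 : (s + 1)^-1 <= 1 by rewrite invf_le1 ?lerDr ?ltr_wpDl // ltW.
have := convex_ineq s (-1) (stored_rho_convex H) (ltW t0) t1.
rewrite (stored_rho_neg H) ?(stored_rho_neg H (s := -1)) ?lerN10 //.
  by rewrite mulr0 addr0 pmulr_rge0.
rewrite le_eqVlt; apply/orP; left; apply/eqP; field; lra.
Qed.

Lemma stored_derivable gamma s0 kappa (rho1 rho : R -> R) (s : R) :
  stored_energy gamma s0 kappa rho1 rho -> derivable rho s 1.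
Proof. by move=> H; have /(_ 0%N s) := stored_rho_smooth H. Qed.

Lemma det_mx2 (A : 'M[R]_2) : \det A = A 0 0 * A 1 1 - A 0 1 * A 1 0.
Proof.
rewrite (expand_det_row _ 0) !big_ord_recl big_ord0 addr0 /cofactor !det_mx11 !mxE.
rewrite /= expr0 expr1 mul1r mulN1r mulrN.
congr (A _ _ * A _ _ - A _ _ * A _ _); exact: val_inj.
Qed.

Lemma sqnorm_mx2 (A : 'M[R]_2) :
  sqnorm_mx A = A 0 0 ^+ 2 + A 0 1 ^+ 2 + (A 1 0 ^+ 2 + A 1 1 ^+ 2).
Proof.
rewrite /sqnorm_mx !big_ord_recl !big_ord0 !addr0.
by congr (A _ _ ^+ 2 + A _ _ ^+ 2 + (A _ _ ^+ 2 + A _ _ ^+ 2)); exact: val_inj.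
Qed.

Lemma ord2_cases (i : 'I_2) : i = 0 \/ i = 1.
Proof. by case: i => [[|[|//]] ?]; [left|right]; exact: val_inj. Qed.

Lemma sqr_le_sum4 (d : 'I_2 -> 'I_2 -> R) i j :
  d j i ^+ 2 <= d 0 0 ^+ 2 + d 0 1 ^+ 2 + (d 1 0 ^+ 2 + d 1 1 ^+ 2).
Proof.
have := sqr_ge0 (d 0 0); have := sqr_ge0 (d 0 1).
have := sqr_ge0 (d 1 0); have := sqr_ge0 (d 1 1).
case: (ord2_cases j) => ->; case: (ord2_cases i) => ->; lra.
Qed.

End StoredEnergy.

Section Minimizer.
Variable R : realType.
Local Notation leb := (@lebesgue_measure R).
Local Notation disc := (@unit_ball R).
Local Notation plane := (measurableTypeR R * measurableTypeR R)%type.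
Local Notation angles := (`[0%R, (2 * pi)%R]%classic : set R).
Local Notation A := (area R).
Local Notation coord := (@component R).
Implicit Types (u : R * R -> R * R) (i j : 'I_2).

Let mD : measurable (disc : set plane) := @measurable_unit_ball R.
Let mC : measurable (angles : set (measurableTypeR R)).
Proof. exact: measurable_itv. Qed.

(** If smooth w_n define the trace g of f, then trace_Poincare for w_n - g shows that
w_n tends to g in L^2, while it also tends to f. *)
Lemma trace_grad_unique (f g : R * R -> R) : W12 f -> has_trace f g -> smooth g ->
  (forall i, {ae A, forall x, disc x -> wgrad f i x = grad g i x}) ->
  {ae A, forall x, disc x -> f x = g x}.
Proof.
move=> Wf Tf Sg ef; have [_ [w [Sw cw cdw cbw]]] := Tf.
have Lf : in_L2 A disc f by case: Wf.
have Lw n : in_L2 A disc (w n) by exact: smooth_L2.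
have Lg : in_L2 A disc g by exact: smooth_L2.
pose v n x := w n x - g x.
have Sv n : smooth (v n) by exact: smoothB.
have bd0 : \int[leb]_(t in angles) (v n (circle_point t) ^+ 2)
    @[n --> \oo] --> (0 : R).
  apply: (@cvg_L2_real _ _ _ leb angles mC (fun n => w n \o @circle_point R)
    (g \o @circle_point R)) => //.
  - by move=> n; exact: smooth_L2_angles.
  - exact: smooth_L2_angles.
have gr0 i : \int[A]_(x in disc) (grad (v n) i x ^+ 2) @[n --> \oo] --> (0 : R).
  have c : cvg_L2 A disc (fun n => grad (w n) i) (grad g i).
    rewrite /cvg_L2 (_ : (fun n => _) =
      (fun n => sqL2norm A disc (partial i (w n) \- weak_partial i f)));
      first exact: cdw.
    apply/funext => n; rewrite /sqL2norm.
    have [m1 _] := grad_L2 i (Sw n); have [m2 _] := grad_L2 i Sg.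
    have [m3 _] := weak_partial_L2 i Wf.
    apply: ge0_ae_eq_integral => //.
    + by apply/measurable_EFinP; apply: measurable_funX; exact: measurable_funB.
    + by apply/measurable_EFinP; apply: measurable_funX; exact: measurable_funB.
    + by move=> x _; rewrite lee_fin sqr_ge0.
    + by move=> x _; rewrite lee_fin sqr_ge0.
    + by apply: ae_imp (ef i) => x H Dx /=; rewrite -(H Dx).
  have := cvg_L2_real mD (fun n => grad_L2 i (Sw n)) (grad_L2 i Sg) c.
  rewrite (_ : (fun n => _) =
    (fun n => \int[A]_(x in disc) (grad (v n) i x ^+ 2))) //.
  apply/funext => n; apply: eq_Rintegral => x _.
  by rewrite /grad /v (partialB i x (Sw n) Sg).
have v0 : \int[A]_(x in disc) (v n x ^+ 2) @[n --> \oo] --> (0 : R).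
  apply: (@squeeze_cvgr _ _ _ _ (fun=> 0) (fun n =>
    \int[leb]_(t in angles) (v n (circle_point t) ^+ 2) +
    (\int[A]_(x in disc) (grad (v n) 0 x ^+ 2) +
     \int[A]_(x in disc) (grad (v n) 1 x ^+ 2)))).
  - apply: nearW => n; rewrite trace_Poincare // andbT.
    by apply: Rintegral_ge0 => x _; exact: sqr_ge0.
  - exact: cvg_cst.
  - rewrite -[X in _ --> X](addr0 0) -[X in _ --> _ + X](addr0 0).
    by apply: cvgD; [exact: bd0|apply: cvgD; exact: gr0].
have cwg : cvg_L2 A disc w g.
  rewrite /cvg_L2 (_ : (fun n => _) =
    (fun n => (\int[A]_(x in disc) (v n x ^+ 2))%:E)).
    by apply/cvg_EFin => //; exact: nearW.
  by apply/funext => n; rewrite L2_sqE //; exact: L2B.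
have Lfg := L2B mD Lf Lg.
have c1 := cvg_L2_pairing mD Lw Lf Lfg cw.
have c2 := cvg_L2_pairing mD Lw Lg Lfg cwg.
have E := cvg_unique (@Rhausdorff R) c1 c2.
have : {ae A, forall x, disc x -> (f \- g) x = 0}.
  apply: (L2_ae_zero mD Lfg).
  rewrite (@eq_Rintegral _ _ _ A disc (fun x => f x * (f \- g) x - g x * (f \- g) x)).
    rewrite RintegralB ?E ?subrr //; exact: L2_integrable_mul.
  by move=> x _; rewrite -mulrBl expr2.
by apply: ae_imp => x H /H /= /eqP; rewrite subr_eq0 => /eqP.
Qed.

Lemma admissible_id : admissible (@id (R * R)).
Proof.
split=> j; first exact/smooth_W12/smooth_component.
exact/smooth_has_trace/smooth_component.
Qed.

Let V : R := fine (A disc).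

Lemma grad_coord i j : grad (coord j) i = fun=> (i == j)%:R.
Proof. by apply/funext => x; exact: partial_component. Qed.

(** Pairing with a coordinate extracts one partial derivative, so that jac_trace
also determines the integral of the divergence. *)
Lemma jac_coord1 (q : 'I_2 -> R * R -> R) :
  jac q (grad (coord 1)) = \int[A]_(x in disc) q 0 x.
Proof.
rewrite /jac !grad_coord /=; apply: eq_Rintegral => x _.
by rewrite mulr1 mulr0 subr0.
Qed.

Lemma jac_coord0 (q : 'I_2 -> R * R -> R) : (forall i, in_L2 A disc (q i)) ->
  jac q (grad (coord 0)) = - \int[A]_(x in disc) q 1 x.
Proof.
move=> Lq; rewrite jacE //; last by move=> i; apply: grad_L2; exact: smooth_component.
rewrite !grad_coord /= (@eq_Rintegral _ _ _ A disc (fun=> 0)); last first.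
  by move=> x _; rewrite mulr0.
rewrite Rintegral_cst // mul0r sub0r; congr (- _).
by apply: eq_Rintegral => x _; rewrite mulr1.
Qed.

Lemma integral_grad_coord i : \int[A]_(x in disc) grad (coord i) i x = V.
Proof. by rewrite grad_coord eqxx Rintegral_cst // mul1r. Qed.

Definition dev u j i (x : R * R) : R :=
  weak_partial i (component j \o u) x - (i == j)%:R.

Definition dev2 u (x : R * R) : R :=
  dev u 0 0 x ^+ 2 + dev u 0 1 x ^+ 2 + (dev u 1 0 x ^+ 2 + dev u 1 1 x ^+ 2).

Lemma dev_L2 u j i : admissible u -> in_L2 A disc (dev u j i).
Proof.
move=> [Wu _]; apply: (L2B mD (g := fun=> (i == j)%:R)).
  exact: weak_partial_L2.
by apply: smooth_L2; exact: smooth_cst.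
Qed.

Lemma dev2_integrable u : admissible u -> A.-integrable disc (EFin \o dev2 u).
Proof.
move=> Au; have I j i := L2_integrable_sqr (dev_L2 j i Au).
have := integrableD mD (integrableD mD (I 0 0) (I 0 1))
  (integrableD mD (I 1 0) (I 1 1)).
by apply: eq_integrable.
Qed.

Definition energy_density (rho : R -> R) u (x : R * R) : R :=
  2^-1 * sqnorm_mx (weak_grad u x) + rho (\det (weak_grad u x)).

(** With c = rho(1), m = rho'(1) and G the weak gradient of u: the energy density in
which rho (det G) is replaced by its tangent c + m (det G - 1), and |G|^2 / 2 is
expanded about the identity matrix. *)
Definition energy_minorant (c m : R) u (x : R * R) : R :=
  2^-1 * dev2 u x + (weak_partial 0 (component 0 \o u) x +
    weak_partial 1 (component 1 \o u) x) +
  m * (weak_partial 0 (component 0 \o u) x * weak_partial 1 (component 1 \o u) x -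
       weak_partial 1 (component 0 \o u) x * weak_partial 0 (component 1 \o u) x) +
  (c - 1 - m).

(** The difference is rho (det G) - rho 1 - m (det G - 1), because
|G|^2 / 2 = |G - Id|^2 / 2 + tr G - 1. *)
Lemma energy_minorantP (rho : R -> R) m u x :
  (forall s, rho 1 + m * (s - 1) <= rho s) ->
  energy_minorant (rho 1) m u x <= energy_density rho u x.
Proof.
move=> Hr; rewrite /energy_density det_mx2 sqnorm_mx2 /weak_grad !mxE.
rewrite /energy_minorant /dev2 /dev /=.
set a := weak_partial 0 (component 0 \o u) x.
set b := weak_partial 1 (component 0 \o u) x.
set c := weak_partial 0 (component 1 \o u) x.
set d := weak_partial 1 (component 1 \o u) x.
have := Hr (a * d - b * c); move: (rho 1) (rho _) a b c d => r1 r a b c d H.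
lra.
Qed.

(** The null Lagrangians tr and det contribute what they do for the identity: 2 V
and m V, where V is the area of the disc. *)
Lemma energy_minorant_integral c m u : admissible u ->
  A.-integrable disc (EFin \o energy_minorant c m u) /\
  \int[A]_(x in disc) energy_minorant c m u x =
  2^-1 * \int[A]_(x in disc) dev2 u x + (1 + c) * V.
Proof.
move=> Au; have [Wu Tu] := Au.
have S j : smooth (coord j) := @smooth_component R j.
pose p j i := weak_partial i (component j \o u).
have Lp j i : in_L2 A disc (p j i) by exact: weak_partial_L2.
have Lc (k : R) : in_L2 A disc (fun=> k) by apply: smooth_L2; exact: smooth_cst.
have Ic (k : R) : A.-integrable disc (EFin \o (fun=> k)).
  by apply: continuous_integrable_ball; apply: smooth_cont; exact: smooth_cst.
have Ip j i : A.-integrable disc (EFin \o p j i).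
  have := L2_integrable_mul mD (Lp j i) (Lc 1); apply: eq_integrable => // x _ /=.
  by rewrite mulr1.
have D (f g : R * R -> R) (If : A.-integrable disc (EFin \o f))
    (Ig : A.-integrable disc (EFin \o g)) :
    A.-integrable disc (EFin \o (fun x => f x + g x)).
  by have := integrableD mD If Ig; apply: eq_integrable.
have Z (k : R) (f : R * R -> R) (If : A.-integrable disc (EFin \o f)) :
    A.-integrable disc (EFin \o (fun x => k * f x)).
  by have := integrableZl mD k If; apply: eq_integrable.
have I1 := Z 2^-1 _ (dev2_integrable Au).
have I2 := D _ _ (Ip 0 0) (Ip 1 1).
have Idet : A.-integrable disc
    (EFin \o (fun x => p 0 0 x * p 1 1 x - p 0 1 x * p 1 0 x)).
  have := integrableB mD (L2_integrable_mul mD (Lp 0 0) (Lp 1 1))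
    (L2_integrable_mul mD (Lp 0 1) (Lp 1 0)).
  by apply: eq_integrable.
have I3 := Z m _ Idet.
have I12 := D _ _ I1 I2; have I123 := D _ _ I12 I3.
split; first exact: (D _ _ I123 (Ic (c - 1 - m))).
rewrite /energy_minorant (RintegralD mD I123 (Ic _)) (RintegralD mD I12 I3).
rewrite (RintegralD mD I1 I2) (RintegralD mD (Ip 0 0) (Ip 1 1)).
rewrite (RintegralZl 2^-1 mD (dev2_integrable Au)) (RintegralZl m mD Idet).
rewrite (Rintegral_cst A mD).
have T j : has_trace (component j \o u) (coord j) := Tu j.
have E00 : \int[A]_(x in disc) p 0 0 x = V.
  have H := jac_trace (Wu 0) (T 0) (S 0) (S 1).
  by rewrite (jac_coord1 (wgrad _)) (jac_coord1 (grad _)) integral_grad_coord in H.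
have E11 : \int[A]_(x in disc) p 1 1 x = V.
  have H := jac_trace (Wu 1) (T 1) (S 1) (S 0).
  rewrite (jac_coord0 (q := wgrad _)) in H; last by move=> i; exact: weak_partial_L2.
  rewrite (jac_coord0 (q := grad _)) in H; last by move=> i; exact: grad_L2.
  by rewrite integral_grad_coord in H; exact: (oppr_inj H).
have Edet : \int[A]_(x in disc) (p 0 0 x * p 1 1 x - p 0 1 x * p 1 0 x) = V.
  have H := jac_trace2 (Wu 0) (T 0) (S 0) (Wu 1) (T 1) (S 1).
  by rewrite (jac_coord1 (grad _)) integral_grad_coord in H.
set Q := Rintegral A disc (dev2 u).
transitivity (2^-1 * Q + (V + V) + m * V + (c - 1 - m) * V); last by ring.
congr (_ + (_ + _) + m * _ + _); [exact: E00|exact: E11|exact: Edet].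
Qed.

Section WithRho.
Variables (gamma s0 kappa : R) (rho1 rho : R -> R).
Hypothesis hrho : stored_energy gamma s0 kappa rho1 rho.

Lemma energy_density_ge0 u x : 0 <= energy_density rho u x.
Proof.
rewrite addr_ge0 ?(stored_ge0 _ hrho) // mulr_ge0 // sqnorm_mx2.
by rewrite !addr_ge0 ?sqr_ge0.
Qed.

Lemma measurable_energy_density u : admissible u ->
  measurable_fun disc (energy_density rho u : plane -> R).
Proof.
move=> [Wu _]; pose p j i := weak_partial i (component j \o u).
have mp j i : measurable_fun disc (p j i : plane -> R).
  by have [] := weak_partial_L2 i (Wu j).
have mrho : measurable_fun setT rho.
  apply: continuous_measurable_fun => s.
  by apply/differentiable_continuous/derivable1_diffP; exact: (stored_derivable hrho).
rewrite (_ : energy_density rho u = fun x =>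
  2^-1 * (p 0 0 x ^+ 2 + p 0 1 x ^+ 2 + (p 1 0 x ^+ 2 + p 1 1 x ^+ 2)) +
  rho (p 0 0 x * p 1 1 x - p 0 1 x * p 1 0 x)); last first.
  by apply/funext => x; rewrite /energy_density det_mx2 sqnorm_mx2 /weak_grad !mxE.
apply: measurable_funD.
  apply: measurable_funM; first exact: measurable_cst.
  by apply: measurable_funD; apply: measurable_funD; apply: measurable_funX.
apply: (measurableT_comp mrho).
by apply: measurable_funB; apply: measurable_funM.
Qed.

(** The representative of the weak gradient of the identity that enters the energy is
only known to be the identity matrix almost everywhere. *)
Lemma energy_id : energy rho id = ((1 + rho 1) * V)%:E.
Proof.
have Sc j : smooth (component j \o @id (R * R)) := @smooth_component R j.
have W j i := weak_partial_smooth i (Sc j).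
have ae4 := ae_and (ae_and (W 0 0) (W 0 1)) (ae_and (W 1 0) (W 1 1)).
rewrite /energy -/(energy_density rho id).
transitivity (\int[A]_(x in disc) (cst (1 + rho 1)%:E) x)%E; last first.
  rewrite integral_cst // EFinM /V fineK // ge0_fin_numE //.
  exact: unit_ball_area.
apply: ge0_ae_eq_integral => //.
- by apply/measurable_EFinP; exact: measurable_energy_density admissible_id.
- by move=> x _; rewrite lee_fin energy_density_ge0.
- move=> x _; rewrite lee_fin addr_ge0 //; exact: (stored_ge0 _ hrho).
apply: ae_imp ae4 => x [[H00 H01] [H10 H11]] Dx.
rewrite /energy_density det_mx2 sqnorm_mx2 /weak_grad !mxE.
rewrite (H00 Dx) (H01 Dx) (H10 Dx) (H11 Dx).
have P i j : partial i (component j \o @id (R * R)) x = (i == j)%:R.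
  exact: partial_component.
rewrite !P /= expr1n expr0n /= !addr0 add0r mulr1 mulr0 subr0 /=.
by congr (_ + _)%:E; field.
Qed.

Lemma energy_lower_bound u : admissible u ->
  ((2^-1 * \int[A]_(x in disc) dev2 u x + (1 + rho 1) * V)%:E <= energy rho u)%E.
Proof.
move=> Au; pose m := 'D_1 rho (1 : R).
have Hr s : rho 1 + m * (s - 1) <= rho s.
  apply: convex_tangent; first exact: stored_rho_convex hrho.
  by apply: derivableP; exact: (stored_derivable hrho).
have [Im Em] := energy_minorant_integral (rho 1) m Au.
rewrite -Em /energy -/(energy_density rho u).
have mE := measurable_energy_density Au.
have [->|fin] := eqVneq (\int[A]_(x in disc) (energy_density rho u x)%:E)%E +oo%E.
  exact: leey.
have Ie : A.-integrable disc (EFin \o energy_density rho u).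
  apply/integrableP; split; first exact/measurable_EFinP.
  under eq_integral do rewrite /= ger0_norm ?energy_density_ge0 //.
  by rewrite ltey.
rewrite /Rintegral fineK; last exact: (integrable_fin_num mD Im).
apply: le_integral => // x _; rewrite lee_fin; exact: energy_minorantP.
Qed.

Lemma dev2_ge0 u x : 0 <= dev2 u x.
Proof. by rewrite !addr_ge0 ?sqr_ge0. Qed.

Lemma id_minimizer : global_minimizer (energy rho) [set u | admissible u] id.
Proof.
split; first exact: admissible_id.
move=> v Av; apply: le_trans (energy_lower_bound Av).
rewrite energy_id lee_fin lerDr mulr_ge0 //.
by apply: Rintegral_ge0 => x _; exact: dev2_ge0.
Qed.

Lemma minimizer_unique u :
  global_minimizer (energy rho) [set v | admissible v] u ->
  {ae A, forall x, disc x -> u x = x}.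
Proof.
move=> [Au Hu]; have [Wu Tu] := Au.
have Q0 : \int[A]_(x in disc) dev2 u x = 0.
  apply/eqP; rewrite eq_le; apply/andP; split; last first.
    by apply: Rintegral_ge0 => x _; exact: dev2_ge0.
  have := le_trans (energy_lower_bound Au) (Hu _ admissible_id).
  rewrite energy_id lee_fin gerDr pmulr_rle0 //.
have Hdev j i : {ae A, forall x, disc x -> dev u j i x = 0}.
  apply: (L2_ae_zero mD (dev_L2 j i Au)).
  apply/eqP; rewrite eq_le; apply/andP; split; last first.
    by apply: Rintegral_ge0 => x _; exact: sqr_ge0.
  rewrite -Q0; apply: le_Rintegral => //.
  - exact: L2_integrable_sqr (dev_L2 j i Au).
  - exact: dev2_integrable.
  by move=> x _; exact: (sqr_le_sum4 (fun j i => dev u j i x)).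
have Hj j : {ae A, forall x, disc x -> component j (u x) = component j x}.
  apply: (trace_grad_unique (Wu j) (Tu j) (@smooth_component R j)) => i.
  apply: ae_imp (Hdev j i) => x H Dx.
  have /eqP := H Dx; rewrite /dev subr_eq0 => /eqP.
  by rewrite -(partial_component i j x).
apply: ae_imp (ae_and (Hj 0) (Hj 1)) => x [H0 H1] Dx.
rewrite [LHS]surjective_pairing [RHS]surjective_pairing.
by congr pair; [exact: H0|exact: H1].
Qed.

End WithRho.

End Minimizer.

Theorem proposition3p3 (R : realType) (gamma s0 kappa : R) (rho1 rho : R -> R)
    (hgamma : 0 < gamma) (hrho : stored_energy gamma s0 kappa rho1 rho) :
  smooth_map (@id (R * R)) /\
  global_minimizer (energy rho) [set u | admissible u] (@id (R * R)) /\
  forall u : R * R -> R * R,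
    global_minimizer (energy rho) [set v | admissible v] u ->
    {ae @area R, forall x, unit_ball x -> u x = x}.
Proof.
split; first by move=> j; exact: smooth_component.
split; first exact: (id_minimizer hrho).
by move=> u; exact: (minimizer_unique hrho).
Qed.
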